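(* Let $F$ be a field, let $D$ be a subring of $F$, and let $\mathfrak{X}$ be the Zariski-Riemann space of $F/D$. Let $Z$ be a nonempty subspace of $\mathfrak{X}$ and let $\mathfrak{S}$ be a dominant system of projective models of $F/D$. Then, as locally ringed spaces, $\operatorname{inv}(Z)=\varprojlim\operatorname{inv}(X(Z))$, where $X$ ranges over $\mathfrak{S}$ and the transition morphisms are those induced by the domination morphisms.
   Context: $\mathfrak{X}$ is the set of all valuation rings $V$ with $D\subseteq V\subseteq F$ having quotient field $F$, with the topology having as a basis of open sets the sets $\{V\in\mathfrak{X}: S\subseteq V\}$, $S$ a finite subset of $F$. A projective model $X$ of $F/D$ is a projective integral scheme over $\operatorname{Spec}(D)$ with function field a subfield of $F$; concretely there are nonzero $f_1,\ldots,f_n\in F$ with $X=\bigcup_i\operatorname{Spec}(D_i)$, $D_i=D[f_1/f_i,\ldots,f_n/f_i]$, where primes $\mathfrak{p}_i$ of $D_i$ and $\mathfrak{p}_j$ of $D_j$ are identified when $(D_i)_{\mathfrak{p}_i}=(D_j)_{\mathfrak{p}_j}$. All stalks $\mathcal{O}_{X,x}$ are viewed as subrings of $F$; $X$ has as a basis of open sets the sets $\{x\in X: f_1,\ldots,f_n\in\mathcal{O}_{X,x}\}$ with $f_1,\dots,f_n\in F$. A projective model $Y$ dominates a projective model $X$ if for each $y\in Y$ there is $x\in X$ with $\mathcal{O}_{X,x}\subseteq\mathcal{O}_{Y,y}$ and $\mathfrak{m}_{X,x}=\mathfrak{m}_{Y,y}\cap\mathcal{O}_{X,x}$; then $y\mapsto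 x$ together with inclusions of sections is the domination morphism $Y\to X$. $V\in\mathfrak{X}$ is centered on $x\in X$ if $\mathcal{O}_{X,x}\subseteq V$ and $\mathfrak{m}_{X,x}=\mathfrak{M}_V\cap\mathcal{O}_{X,x}$ ($\mathfrak{M}_V$ the maximal ideal of $V$); each $V$ is centered on a unique point of each $X$. A dominant system is a collection of projective models such that for every pair of projective models of $F/D$ there is a member of the collection dominating both. For $Z\subseteq\mathfrak{X}$, $X(Z)$ is the set of centers in $X$ of the members of $Z$. For a subset $Y$ of a spectral space, $\operatorname{inv}(Y)$ is the intersection of all quasicompact open subsets containing $Y$. ($\mathfrak{X}$ and the projective models are spectral spaces.) A nonempty inverse closed subset $Y$ (i.e. $Y=\operatorname{inv}(Y)$) of a projective model $X$ is a locally ringed space with structure sheaf $\mathcal{O}_Y(U)=\bigcap_{x\in U}\mathcal{O}_{X,x}$ for nonempty open $U\subseteq Y$ (inclusions as restriction maps); an inverse closed subset of $\mathfrak{X}$ is one similarly, with $\mathcal{O}(U)=\bigcap_{V\in U}V$. *)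

(* Defs.v *)
From HB Require Import structures.
From mathcomp Require Import all_boot all_order all_algebra generic_quotient.
From mathcomp Require Import finmap boolp classical_sets functions.
From mathcomp Require Import topology.

Set Implicit Arguments.
Unset Strict Implicit.
Unset Printing Implicit Defensive.

Import GRing.Theory.

Local Open Scope classical_set_scope.
Local Open Scope ring_scope.
Local Open Scope quotient_scope.

(* Rings are [comPzRingType]s: the ring of sections over the empty set is the
   zero ring. *)

Definition is_ideal (R : comPzRingType) (I : set R) : Prop :=
  [/\ I 0, forall a b, I a -> I b -> I (a + b) & forall r a, I a -> I (r * a)].

Definition maximal_ideal (R : comPzRingType) (I : set R) : Prop :=
  [/\ is_ideal I, I <> setT &
      forall J, is_ideal J -> I `<=` J -> J = I \/ J = setT].

Definition local_ring (R : comPzRingType) : Prop :=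
  exists! M : set R, maximal_ideal M.

Definition local_hom (A B : comPzRingType) (phi : A -> B) : Prop :=
  forall (M : set A) (N : set B),
    maximal_ideal M -> maximal_ideal N -> phi @` M `<=` N.

Definition unit_elt (R : comPzRingType) (a : R) : Prop := exists b, a * b = 1.

Lemma ideal1 (R : comPzRingType) (I : set R) : is_ideal I -> I 1 -> I = setT.
Proof.
by case=> _ _ Im I1; apply/seteqP; split=> // x _; rewrite -[x]mulr1; exact: Im.
Qed.

Lemma local_ring_nonunits (R : comPzRingType) :
  ~ unit_elt (0 : R) ->
  (forall a b : R, ~ unit_elt a -> ~ unit_elt b -> ~ unit_elt (a + b)) ->
  local_ring R.
Proof.
move=> n0 nD; set M := [set a : R | ~ unit_elt a].
have idM : is_ideal M.
  split=> // r a /= na [b rab]; apply: na; exists (r * b).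
  by rewrite mulrCA mulrA.
have sub J : is_ideal J -> J <> setT -> J `<=` M.
  move=> idJ JT a Ja [b ab]; apply: JT; apply: ideal1 => //.
  by rewrite -ab mulrC; case: idJ => _ _; apply.
have nM1 : M <> setT.
  move=> MT; have : M 1 by rewrite MT.
  by apply; exists 1; rewrite mulr1.
exists M; split.
  split=> // J idJ MJ; case: (pselect (J = setT)) => [->|JT]; [by right|left].
  by apply/seteqP; split=> //; exact: sub.
move=> N [idN NT Nmax]; case: (Nmax _ idM (sub _ idN NT)) => //.
Qed.

Record opens (T : topologicalType) := Opens {
  oset :> set T;
  open_oset : open oset
}.

Lemma opens_eq (T : topologicalType) (U V : opens T) :
  oset U = oset V -> U = V.
Proof.
case: U V => [U oU] [V oV] /= E; rewrite -E in oV *.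
by congr Opens; exact: Prop_irrelevance.
Qed.

Definition opensI (T : topologicalType) (U V : opens T) : opens T :=
  Opens (openI (open_oset U) (open_oset V)).

Lemma open_preim (S T : topologicalType) (f : S -> T) (U : opens T) :
  continuous f -> open (f @^-1` U).
Proof. by move=> /continuousP; apply; exact: open_oset. Qed.

Definition preim_opens (S T : topologicalType) (f : S -> T)
  (cf : continuous f) (U : opens T) : opens S := Opens (open_preim U cf).

Record ringed_space := RingedSpace {
  rs_space :> topologicalType;
  sect : opens rs_space -> comPzRingType;
  res : forall U V : opens rs_space, V `<=` U -> {rmorphism sect U -> sect V};
  res_id : forall (U : opens rs_space) (h : U `<=` U) (s : sect U),
    res h s = s;
  res_res : forall (U V W : opens rs_space) (h : V `<=` U) (k : W `<=` V)
    (l : W `<=` U) (s : sect U), res k (res h s) = res l s;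
  sheaf_separated : forall (U : opens rs_space) (I : Type)
    (V : I -> opens rs_space) (h : forall i, V i `<=` U),
    U `<=` \bigcup_i V i ->
    forall s t : sect U, (forall i, res (h i) s = res (h i) t) -> s = t;
  sheaf_gluing : forall (U : opens rs_space) (I : Type)
    (V : I -> opens rs_space) (h : forall i, V i `<=` U),
    U `<=` \bigcup_i V i ->
    forall s : (forall i, sect (V i)),
      (forall i j (hi : opensI (V i) (V j) `<=` V i)
         (hj : opensI (V i) (V j) `<=` V j), res hi (s i) = res hj (s j)) ->
      exists t : sect U, forall i, res (h i) t = s i
}.

Record pregerm (X : ringed_space) (x : X) := Pregerm {
  pg_dom : opens X;
  pg_mem : oset pg_dom x;
  pg_sec : sect pg_dom
}.

HB.instance Definition _ (X : ringed_space) (x : X) :=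
  gen_eqMixin (pregerm x).
HB.instance Definition _ (X : ringed_space) (x : X) :=
  gen_choiceMixin (pregerm x).

Section Stalk.
Variables (X : ringed_space) (x : X).

Definition germ_eq (g h : pregerm x) : Prop :=
  exists (W : opens X) (kg : W `<=` pg_dom g) (kh : W `<=` pg_dom h),
    oset W x /\ res kg (pg_sec g) = res kh (pg_sec h).

Definition germ_eqb (g h : pregerm x) : bool := `[< germ_eq g h >].

Lemma germ_eqb_refl : reflexive germ_eqb.
Proof.
move=> g; apply/asboolP; exists (pg_dom g), (@subset_refl _ _), (@subset_refl _ _).
by split=> //; exact: pg_mem.
Qed.

Lemma germ_eqb_sym : symmetric germ_eqb.
Proof.
have sy g h : germ_eqb g h -> germ_eqb h g.
  by move=> /asboolP[W [kg [kh [Wx e]]]]; apply/asboolP; exists W, kh, kg.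
by move=> g h; apply/idP/idP; exact: sy.
Qed.

Lemma germ_eqb_trans : transitive germ_eqb.
Proof.
move=> h g k /asboolP[W [ag [ah [Wx e]]]] /asboolP[W' [bh [bk [W'x e']]]].
apply/asboolP; pose V := opensI W W'.
have VW : V `<=` W by apply: subIsetl.
have VW' : V `<=` W' by apply: subIsetr.
exists V, (subset_trans VW ag), (subset_trans VW' bk); split=> //.
rewrite -(res_res ag VW) -(res_res bk VW') e -e'.
by rewrite (res_res _ _ (subset_trans VW ah)) (res_res _ _ (subset_trans VW ah)).
Qed.

Canonical germ_equiv := EquivRel germ_eqb germ_eqb_refl germ_eqb_sym
  germ_eqb_trans.

(* The stalk at [x]: the direct limit of the rings of sections over the open
   neighborhoods of [x], as a quotient of the set of pairs (U, s). *)
Definition stalk : Type := {eq_quot germ_equiv}.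
HB.instance Definition _ := Choice.on stalk.
HB.instance Definition _ := Quotient.on stalk.

Definition germ (U : opens X) (xU : oset U x) (s : sect U) : stalk :=
  \pi_stalk (Pregerm xU s).

Lemma germP (U V : opens X) (xU : oset U x) (xV : oset V x) (s : sect U) (t : sect V) :
  germ xU s = germ xV t <->
  exists (W : opens X) (kU : W `<=` U) (kV : W `<=` V),
    oset W x /\ res kU s = res kV t.
Proof.
split=> [/eqmodP/asboolP[W [kU [kV e]]]|[W [kU [kV e]]]]; first by exists W, kU, kV.
by apply/eqmodP/asboolP; exists W, kU, kV.
Qed.

Lemma germ_res (U V : opens X) (xU : oset U x) (xV : oset V x) (h : V `<=` U)
  (s : sect U) : germ xV (res h s) = germ xU s.
Proof.
apply/germP; exists V, (@subset_refl _ _), h; split=> //.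
by rewrite res_id.
Qed.

Lemma germ_surj (g : stalk) : exists (U : opens X) (xU : oset U x) (s : sect U),
  g = germ xU s.
Proof.
by elim/quotW: g => -[U xU s]; exists U, xU, s.
Qed.

Lemma germ_surj2 (g h : stalk) : exists (U : opens X) (xU : oset U x) (s t : sect U),
  g = germ xU s /\ h = germ xU t.
Proof.
case: (germ_surj g) => U [xU [s ->]]; case: (germ_surj h) => V [xV [t ->]].
pose W := opensI U V; have Wx : oset W x by [].
have WU : W `<=` U by apply: subIsetl.
have WV : W `<=` V by apply: subIsetr.
by exists W, Wx, (res WU s), (res WV t); rewrite !germ_res.
Qed.

Lemma germ_surj3 (g h k : stalk) :
  exists (U : opens X) (xU : oset U x) (s t u : sect U),
  [/\ g = germ xU s, h = germ xU t & k = germ xU u].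
Proof.
case: (germ_surj2 g h) => U [xU [s [t [-> ->]]]].
case: (germ_surj k) => V [xV [u ->]].
pose W := opensI U V; have Wx : oset W x by [].
have WU : W `<=` U by apply: subIsetl.
have WV : W `<=` V by apply: subIsetr.
by exists W, Wx, (res WU s), (res WU t), (res WV u); rewrite !germ_res.
Qed.

Definition germ_op2 (op : forall U : opens X, sect U -> sect U -> sect U)
    (g h : stalk) : stalk :=
  let a := repr g in let b := repr h in
  germ (conj (pg_mem a) (pg_mem b) : oset (opensI (pg_dom a) (pg_dom b)) x)
    (op _ (res (@subIsetl _ _ _ : opensI (pg_dom a) (pg_dom b) `<=` pg_dom a)
              (pg_sec a))
          (res (@subIsetr _ _ _ : opensI (pg_dom a) (pg_dom b) `<=` pg_dom b)
              (pg_sec b))).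

Lemma repr_germ (U : opens X) (xU : oset U x) (s : sect U) :
  germ (pg_mem (repr (germ xU s))) (pg_sec (repr (germ xU s))) = germ xU s.
Proof.
rewrite -[RHS]reprK /germ; congr (\pi_stalk _).
by case: (repr _).
Qed.

Lemma germ_op2E (op : forall U : opens X, sect U -> sect U -> sect U)
  (opR : forall (U V : opens X) (h : V `<=` U) (s t : sect U),
     res h (op U s t) = op V (res h s) (res h t))
  (U : opens X) (xU : oset U x) (s t : sect U) :
  germ_op2 op (germ xU s) (germ xU t) = germ xU (op U s t).
Proof.
rewrite /germ_op2.
have /germP[W [WA [WU [Wx eA]]]] := repr_germ xU s.
have /germP[W' [WB [WU' [Wx' eB]]]] := repr_germ xU t.
apply/germP.
pose V := opensI W W'.
have VW : V `<=` W by apply: subIsetl.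
have VW' : V `<=` W' by apply: subIsetr.
have VAB : V `<=`
    opensI (pg_dom (repr (germ xU s))) (pg_dom (repr (germ xU t))).
  by move=> y [Wy W'y]; exact (conj (WA y Wy) (WB y W'y)).
have VU : V `<=` U by apply: subset_trans VW WU.
exists V, VAB, VU; split=> //; rewrite !opR.
rewrite (res_res _ VAB (subset_trans VW WA)) (res_res _ VAB (subset_trans VW' WB)).
by rewrite -(res_res WA VW) eA -(res_res WB VW') eB !(res_res _ _ VU).
Qed.

Definition topO : opens X := Opens openT.

Definition stalk_zero : stalk := germ (I : oset topO x) 0.
Definition stalk_one : stalk := germ (I : oset topO x) 1.
Definition stalk_add : stalk -> stalk -> stalk :=
  germ_op2 (fun U => @GRing.add (sect U)).
Definition stalk_mul : stalk -> stalk -> stalk :=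
  germ_op2 (fun U => @GRing.mul (sect U)).
Definition stalk_opp (g : stalk) : stalk :=
  germ (pg_mem (repr g)) (- pg_sec (repr g)).

Lemma germ0E (U : opens X) (xU : oset U x) : stalk_zero = germ xU 0.
Proof.
have UT : U `<=` topO by [].
by rewrite /stalk_zero -(germ_res _ xU UT) rmorph0.
Qed.

Lemma germ1E (U : opens X) (xU : oset U x) : stalk_one = germ xU 1.
Proof.
have UT : U `<=` topO by [].
by rewrite /stalk_one -(germ_res _ xU UT) rmorph1.
Qed.

Lemma germDE (U : opens X) (xU : oset U x) (s t : sect U) :
  stalk_add (germ xU s) (germ xU t) = germ xU (s + t).
Proof. by apply: germ_op2E => V W h a b; rewrite rmorphD. Qed.

Lemma germME (U : opens X) (xU : oset U x) (s t : sect U) :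
  stalk_mul (germ xU s) (germ xU t) = germ xU (s * t).
Proof. by apply: germ_op2E => V W h a b; rewrite rmorphM. Qed.

Lemma germNE (U : opens X) (xU : oset U x) (s : sect U) :
  stalk_opp (germ xU s) = germ xU (- s).
Proof.
have /germP[W [WA [WU [Wx eA]]]] := repr_germ xU s.
by apply/germP; exists W, WA, WU; rewrite !rmorphN eA.
Qed.

Lemma stalk_addA : associative stalk_add.
Proof.
move=> g h k; case: (germ_surj3 g h k) => U [xU [s [t [u [-> -> ->]]]]].
by rewrite !germDE addrA.
Qed.

Lemma stalk_addC : commutative stalk_add.
Proof.
move=> g h; case: (germ_surj2 g h) => U [xU [s [t [-> ->]]]].
by rewrite !germDE addrC.
Qed.

Lemma stalk_add0 : left_id stalk_zero stalk_add.
Proof.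
move=> g; case: (germ_surj g) => U [xU [s ->]].
by rewrite (germ0E xU) germDE add0r.
Qed.

Lemma stalk_addN : left_inverse stalk_zero stalk_opp stalk_add.
Proof.
move=> g; case: (germ_surj g) => U [xU [s ->]].
by rewrite germNE germDE addNr -germ0E.
Qed.

HB.instance Definition _ := GRing.isZmodule.Build stalk
  stalk_addA stalk_addC stalk_add0 stalk_addN.

Lemma stalk_mulA : associative stalk_mul.
Proof.
move=> g h k; case: (germ_surj3 g h k) => U [xU [s [t [u [-> -> ->]]]]].
by rewrite !germME mulrA.
Qed.

Lemma stalk_mulC : commutative stalk_mul.
Proof.
move=> g h; case: (germ_surj2 g h) => U [xU [s [t [-> ->]]]].
by rewrite !germME mulrC.
Qed.

Lemma stalk_mul1 : left_id stalk_one stalk_mul.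
Proof.
move=> g; case: (germ_surj g) => U [xU [s ->]].
by rewrite (germ1E xU) germME mul1r.
Qed.

Lemma stalk_mulDl : left_distributive stalk_mul stalk_add.
Proof.
move=> g h k; case: (germ_surj3 g h k) => U [xU [s [t [u [-> -> ->]]]]].
by rewrite !(germME, germDE) mulrDl.
Qed.

HB.instance Definition _ := GRing.Zmodule_isComPzRing.Build stalk
  stalk_mulA stalk_mulC stalk_mul1 stalk_mulDl.

Lemma germ0 (U : opens X) (xU : oset U x) : germ xU 0 = 0.
Proof. by rewrite -germ0E. Qed.

Lemma germ1 (U : opens X) (xU : oset U x) : germ xU 1 = 1.
Proof. by rewrite -germ1E. Qed.

Lemma germD (U : opens X) (xU : oset U x) (s t : sect U) :
  germ xU (s + t) = germ xU s + germ xU t.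
Proof. by rewrite -germDE. Qed.

Lemma germN (U : opens X) (xU : oset U x) (s : sect U) :
  germ xU (- s) = - germ xU s.
Proof. by rewrite -germNE. Qed.

Lemma germM (U : opens X) (xU : oset U x) (s t : sect U) :
  germ xU (s * t) = germ xU s * germ xU t.
Proof. by rewrite -germME. Qed.

End Stalk.

Record rs_mor (X Y : ringed_space) := RsMor {
  mor_fun :> X -> Y;
  mor_cont : continuous mor_fun;
  mor_sharp : forall U : opens Y,
    {rmorphism sect U -> sect (preim_opens mor_cont U)};
  mor_natural : forall (U V : opens Y) (h : V `<=` U)
    (k : preim_opens mor_cont V `<=` preim_opens mor_cont U) (s : sect U),
    mor_sharp V (res h s) = res k (mor_sharp U s)
}.

Arguments mor_cont {X Y} _ _ _ _.
Arguments mor_sharp {X Y} _ U.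

Section StalkMap.
Variables (X Y : ringed_space) (f : rs_mor X Y) (x : X).

Definition stalk_map (g : stalk (f x)) : stalk x :=
  @germ X x (preim_opens (mor_cont f) (pg_dom (repr g))) (pg_mem (repr g))
    (mor_sharp f _ (pg_sec (repr g))).

Lemma stalk_map_germ (U : opens Y) (xU : oset U (f x)) (s : sect U) :
  stalk_map (germ xU s) =
  @germ X x (preim_opens (mor_cont f) U) xU (mor_sharp f U s).
Proof.
have /germP[W [WA [WU [Wx e]]]] := repr_germ xU s.
apply/germP.
have preS A : W `<=` oset A ->
    preim_opens (mor_cont f) W `<=` preim_opens (mor_cont f) A.
  by move=> h y; exact: h.
exists (preim_opens (mor_cont f) W), (preS _ WA), (preS _ WU); split=> //.
by rewrite -(mor_natural WA) -(mor_natural WU) e.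
Qed.

Lemma stalk_map_is_zmod_morphism : zmod_morphism stalk_map.
Proof.
move=> g h; case: (germ_surj2 g h) => U [xU [s [t [-> ->]]]].
by rewrite -germN -germD !stalk_map_germ rmorphB -germN -germD.
Qed.

Lemma stalk_map_is_monoid_morphism : monoid_morphism stalk_map.
Proof.
split=> [|g h].
  have h1 := @germ1 Y (f x) (@topO Y) I.
  by rewrite -h1 stalk_map_germ rmorph1 germ1.
case: (germ_surj2 g h) => U [xU [s [t [-> ->]]]].
by rewrite -germM !stalk_map_germ rmorphM germM.
Qed.

HB.instance Definition _ := GRing.isZmodMorphism.Build _ _ stalk_map
  stalk_map_is_zmod_morphism.
HB.instance Definition _ := GRing.isMonoidMorphism.Build _ _ stalk_map
  stalk_map_is_monoid_morphism.

End StalkMap.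

Record locally_ringed_space := LocallyRingedSpace {
  lrs_rs :> ringed_space;
  lrs_local : forall x : lrs_rs, local_ring (stalk x)
}.

Record lrs_mor (X Y : locally_ringed_space) := LrsMor {
  lrs_mor_rs :> rs_mor X Y;
  lrs_mor_local : forall x : X, local_hom (@stalk_map X Y lrs_mor_rs x)
}.

(* Equality of morphisms, stated without transporting sections along an equality
   of open sets. *)
Definition mor_eq (X Y : locally_ringed_space) (f g : lrs_mor X Y) : Prop :=
  (forall x, f x = g x) /\
  forall (U : opens Y) (s : sect U) (W : opens X)
    (hf : W `<=` preim_opens (mor_cont f) U)
    (hg : W `<=` preim_opens (mor_cont g) U),
    res hf (mor_sharp f U s) = res hg (mor_sharp g U s).

Section Composition.
Variables (X Y Z : locally_ringed_space) (g : lrs_mor Y Z) (f : lrs_mor X Y).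

Definition comp_fun : X -> Z := g \o f.

Lemma comp_cont : continuous comp_fun.
Proof.
move=> x; apply: continuous_comp; [exact: (mor_cont f)|exact: (mor_cont g)].
Qed.

Lemma comp_dom (U : opens Z) : preim_opens comp_cont U `<=`
  preim_opens (mor_cont f) (preim_opens (mor_cont g) U).
Proof. by []. Qed.

(* The restriction is along an identity of open sets. *)
Definition comp_sharp (U : opens Z) :
    {rmorphism sect U -> sect (preim_opens comp_cont U)} :=
  res (@comp_dom U) \o
  (mor_sharp f (preim_opens (mor_cont g) U) \o mor_sharp g U).

Lemma comp_natural (U V : opens Z) (h : V `<=` U)
  (k : preim_opens comp_cont V `<=` preim_opens comp_cont U) (s : sect U) :
  comp_sharp V (res h s) = res k (comp_sharp U s).
Proof.
rewrite /comp_sharp /=.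
have hg : preim_opens (mor_cont g) V `<=` preim_opens (mor_cont g) U.
  by move=> y; exact: h.
have hf : preim_opens (mor_cont f) (preim_opens (mor_cont g) V) `<=`
          preim_opens (mor_cont f) (preim_opens (mor_cont g) U).
  by move=> y; exact: h.
rewrite (mor_natural h hg) (mor_natural hg hf).
by rewrite !(res_res _ _ (subset_trans (@comp_dom V) hf)).
Qed.

Definition comp_rs_mor : rs_mor X Z := RsMor comp_natural.

Lemma comp_stalk_map (x : X) (a : stalk (g (f x))) :
  @stalk_map _ _ comp_rs_mor x a = stalk_map (@stalk_map _ _ g (f x) a).
Proof.
case: (germ_surj a) => U [xU [s ->]].
rewrite (@stalk_map_germ _ _ comp_rs_mor x U xU s) !stalk_map_germ.
exact: germ_res.
Qed.

Lemma comp_local (x : X) : local_hom (@stalk_map X Z comp_rs_mor x).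
Proof.
move=> M N mM mN _ [a Ma <-].
case: (lrs_local (f x)) => P [mP _].
rewrite comp_stalk_map; apply: (lrs_mor_local mP mN).
by exists (@stalk_map _ _ g (f x) a) => //; apply: (lrs_mor_local mM mP); exists a.
Qed.

Definition comp_mor : lrs_mor X Z := LrsMor comp_local.

End Composition.

Record inverse_system (I : Type) (le : I -> I -> Prop) := InverseSystem {
  is_obj :> I -> locally_ringed_space;
  is_trans : forall i j, le i j -> lrs_mor (is_obj j) (is_obj i)
}.

Definition is_cone (I : Type) (le : I -> I -> Prop) (S : inverse_system le)
    (T : locally_ringed_space) (q : forall i, lrs_mor T (S i)) : Prop :=
  forall i j (h : le i j), mor_eq (comp_mor (is_trans S h) (q j)) (q i).

Definition is_limit (I : Type) (le : I -> I -> Prop) (S : inverse_system le)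
    (L : locally_ringed_space) (p : forall i, lrs_mor L (S i)) : Prop :=
  is_cone p /\
  forall (T : locally_ringed_space) (q : forall i, lrs_mor T (S i)),
    is_cone q ->
    exists u : lrs_mor T L,
      (forall i, mor_eq (comp_mor (p i) u) (q i)) /\
      forall v : lrs_mor T L,
        (forall i, mor_eq (comp_mor (p i) v) (q i)) -> mor_eq v u.

Definition is_subring (F : fieldType) (A : set F) : Prop :=
  [/\ A 1, forall a b, A a -> A b -> A (a - b) &
      forall a b, A a -> A b -> A (a * b)].

(* The non-units of [A], i.e. its maximal ideal when [A] is local. *)
Definition max_ideal (F : fieldType) (A : set F) : set F :=
  [set a | A a /\ ~ exists2 b, A b & a * b = 1].

Definition is_local_subring (F : fieldType) (A : set F) : Prop :=
  is_subring A /\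
  forall a b, max_ideal A a -> max_ideal A b -> max_ideal A (a + b).

(* [B] dominates [A]: for a valuation ring [B], it is centered on [A]. *)
Definition centered (F : fieldType) (B A : set F) : Prop :=
  A `<=` B /\ max_ideal A = max_ideal B `&` A.

(* The Zariski-Riemann space and the projective models are both families of
   local subrings of [F] with a largest member (the generic point), with the
   topology and the structure sheaf given by the same formulas. *)
Record local_family (F : fieldType) := LocalFamily {
  lf_set : set (set F);
  lf_local : forall A, lf_set A -> is_local_subring A;
  lf_generic : forall A, lf_set A ->
    exists2 K, lf_set K & forall B, lf_set B -> B `<=` K
}.

Definition points (F : fieldType) (X : local_family F) : Type := lf_set X.

HB.instance Definition _ (F : fieldType) (X : local_family F) :=
  Choice.on (points X).

(* The points of [X] are subrings of [F]: [ring_at x] is O_{X,x}. *)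
Definition ring_at (F : fieldType) (X : local_family F) (x : points X) :
  set F := \val x.

Lemma ring_atP (F : fieldType) (X : local_family F) (x : points X) :
  lf_set X (ring_at x).
Proof. exact: set_mem (valP x). Qed.

Definition basic_open (F : fieldType) (X : local_family F) (S : {fset F}) :
  set (points X) := [set x | [set` S] `<=` ring_at x].

Lemma basic_cover (F : fieldType) (X : local_family F) :
  \bigcup_(S in [set: {fset F}]) @basic_open F X S = setT.
Proof. by apply/seteqP; split=> // x _; exists fset0. Qed.

Lemma basic_join (F : fieldType) (X : local_family F) (S T : {fset F})
  (x : points X) : [set: {fset F}] S -> [set: {fset F}] T ->
  @basic_open F X S x -> @basic_open F X T x ->
  exists R, [/\ [set: {fset F}] R, @basic_open F X R x &
    @basic_open F X R `<=` @basic_open F X S `&` @basic_open F X T].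
Proof.
move=> _ _ Sx Tx; exists (S `|` T)%fset; split=> //.
  by move=> a /=; rewrite inE => /orP[]; [exact: Sx|exact: Tx].
by move=> y ST; split=> a /= aS; apply: ST; rewrite /= inE aS ?orbT.
Qed.

HB.instance Definition _ (F : fieldType) (X : local_family F) :=
  isBaseTopological.Build (points X) (@basic_cover F X) (@basic_join F X).

Lemma basic_open_open (F : fieldType) (X : local_family F) (S : {fset F}) :
  open (@basic_open F X S).
Proof. by exists [set S] => //; rewrite bigcup_set1. Qed.

Lemma open_basicP (F : fieldType) (X : local_family F) (U : set (points X)) :
  open U <-> forall x, U x -> exists2 S, basic_open S x & basic_open S `<=` U.
Proof.
split=> [[D _ <-] x [S DS Sx]|h]; first by exists S => // y Sy; exists S.
exists [set S | basic_open S `<=` U] => //; apply/seteqP; split=> [x [S]|x].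
  by move=> /= SU /SU.
by move=> /h[S Sx SU]; exists S.
Qed.

Lemma open_mem (F : fieldType) (X : local_family F) (a : F) :
  open [set x : points X | ring_at x a].
Proof.
apply/open_basicP => x xa; exists [fset a]%fset.
  by move=> b /=; rewrite inE => /eqP->.
by move=> y; apply; rewrite /= inE.
Qed.

Lemma open_up (F : fieldType) (X : local_family F) (U : set (points X))
  (x y : points X) : open U -> U x -> ring_at x `<=` ring_at y -> U y.
Proof.
move=> /open_basicP oU /oU[S Sx SU] xy; apply: SU.
exact: subset_trans Sx xy.
Qed.

(* [compact] does not include separation: it is quasicompactness. *)
Definition inv (T : topologicalType) (Y : set T) : set T :=
  \bigcap_(U in [set U : set T | [/\ open U, compact U & Y `<=` U]]) U.

Definition inverse_closed (T : topologicalType) (Y : set T) : Prop :=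
  Y = inv Y.

Lemma sub_inv (T : topologicalType) (Y : set T) : Y `<=` inv Y.
Proof. by move=> y Yy U [_ _]; apply. Qed.

Lemma inv_inverse_closed (T : topologicalType) (Y : set T) :
  inverse_closed (inv Y).
Proof.
apply/seteqP; split; first exact: sub_inv.
move=> x xY U [oU cU YU]; apply: xY; split=> //.
by move=> y; apply; split.
Qed.

Section InverseClosedSpace.
Variables (F : fieldType) (X : local_family F) (Y : set (points X)).

Definition ring_in (y : Y) : set F := ring_at (\val y).

(* For U nonempty this is the intersection of the local rings at the points of
   U; for U empty it is the zero ring, whose unit is 0. *)
Definition sec_set (U : opens Y) : set F :=
  [set a | (U !=set0 \/ a = 0) /\ forall y, oset U y -> ring_in y a].

Definition sec (U : opens Y) : Type := sec_set U.

HB.instance Definition _ (U : opens Y) := Choice.on (sec U).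

Definition sec_val (U : opens Y) (a : sec U) : F := \val a.

Definition Sec (U : opens Y) (a : F) (h : sec_set U a) : sec U :=
  exist _ a (mem_set h).

Lemma sec_inj (U : opens Y) : injective (@sec_val U).
Proof. exact: val_inj. Qed.

Lemma secP (U : opens Y) (a : sec U) : sec_set U (sec_val a).
Proof. exact: set_mem (valP a). Qed.

Lemma ring_in_subring (y : Y) : is_subring (ring_in y).
Proof. by case: (lf_local (ring_atP (\val y))). Qed.

Lemma ring_in_local (y : Y) : is_local_subring (ring_in y).
Proof. exact: lf_local (ring_atP (\val y)). Qed.

Definition one_on (U : opens Y) : F := if `[< U !=set0 >] then 1 else 0.

Lemma one_onT (U : opens Y) : U !=set0 -> one_on U = 1.
Proof. by move=> h; rewrite /one_on asboolT. Qed.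

Lemma one_onF (U : opens Y) : ~ (U !=set0) -> one_on U = 0.
Proof. by move=> h; rewrite /one_on asboolF. Qed.

Lemma sec_set0 (U : opens Y) : sec_set U 0.
Proof.
split=> [|y _]; first by right.
by case: (ring_in_subring y) => r1 rB _; rewrite -(subrr 1); exact: rB.
Qed.

Lemma sec_setB (U : opens Y) a b :
  sec_set U a -> sec_set U b -> sec_set U (a - b).
Proof.
move=> [ha ra] [hb rb]; split=> [|y Uy]; last first.
  by case: (ring_in_subring y) => _ rB _; apply: rB; [exact: ra|exact: rb].
case: ha hb => [|->]; first by left.
by case=> [|->]; [left|right; rewrite subrr].
Qed.

Lemma sec_setN (U : opens Y) a : sec_set U a -> sec_set U (- a).
Proof. by move=> h; rewrite -sub0r; apply: sec_setB => //; exact: sec_set0. Qed.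

Lemma sec_setD (U : opens Y) a b :
  sec_set U a -> sec_set U b -> sec_set U (a + b).
Proof.
by move=> ha hb; rewrite -[b]opprK; apply: sec_setB => //; exact: sec_setN.
Qed.

Lemma sec_setM (U : opens Y) a b :
  sec_set U a -> sec_set U b -> sec_set U (a * b).
Proof.
move=> [ha ra] [hb rb]; split=> [|y Uy]; last first.
  by case: (ring_in_subring y) => _ _ rM; apply: rM; [exact: ra|exact: rb].
by case: ha => [|->]; [left|right; rewrite mul0r].
Qed.

Lemma sec_set1 (U : opens Y) : sec_set U (one_on U).
Proof.
have [h|h] := pselect (U !=set0); last by rewrite one_onF //; exact: sec_set0.
rewrite one_onT //; split=> [|y _]; first by left.
by case: (ring_in_subring y).
Qed.

Lemma sec_mul1 (U : opens Y) a : sec_set U a -> one_on U * a = a.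
Proof.
by move=> [[/one_onT->|->] _]; rewrite ?mul1r ?mulr0.
Qed.

Definition sec_zero (U : opens Y) : sec U := Sec (sec_set0 U).
Definition sec_one (U : opens Y) : sec U := Sec (sec_set1 U).
Definition sec_opp (U : opens Y) (a : sec U) : sec U := Sec (sec_setN (secP a)).
Definition sec_add (U : opens Y) (a b : sec U) : sec U :=
  Sec (sec_setD (secP a) (secP b)).
Definition sec_mul (U : opens Y) (a b : sec U) : sec U :=
  Sec (sec_setM (secP a) (secP b)).

Lemma sec_addA (U : opens Y) : associative (@sec_add U).
Proof. by move=> a b c; apply: sec_inj; exact: addrA. Qed.
Lemma sec_addC (U : opens Y) : commutative (@sec_add U).
Proof. by move=> a b; apply: sec_inj; exact: addrC. Qed.
Lemma sec_add0 (U : opens Y) : left_id (sec_zero U) (@sec_add U).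
Proof. by move=> a; apply: sec_inj; exact: add0r. Qed.
Lemma sec_addN (U : opens Y) : left_inverse (sec_zero U) (@sec_opp U) (@sec_add U).
Proof. by move=> a; apply: sec_inj; exact: addNr. Qed.

HB.instance Definition _ (U : opens Y) := GRing.isZmodule.Build (sec U)
  (@sec_addA U) (@sec_addC U) (@sec_add0 U) (@sec_addN U).

Lemma sec_mulA (U : opens Y) : associative (@sec_mul U).
Proof. by move=> a b c; apply: sec_inj; exact: mulrA. Qed.
Lemma sec_mulC (U : opens Y) : commutative (@sec_mul U).
Proof. by move=> a b; apply: sec_inj; exact: mulrC. Qed.
Lemma sec_mul1l (U : opens Y) : left_id (sec_one U) (@sec_mul U).
Proof. by move=> a; apply: sec_inj; apply: sec_mul1; exact: secP. Qed.
Lemma sec_mulDl (U : opens Y) : left_distributive (@sec_mul U) (@sec_add U).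
Proof. by move=> a b c; apply: sec_inj; exact: mulrDl. Qed.

HB.instance Definition _ (U : opens Y) := GRing.Zmodule_isComPzRing.Build (sec U)
  (@sec_mulA U) (@sec_mulC U) (@sec_mul1l U) (@sec_mulDl U).

Section Restriction.
Variables (U V : opens Y) (h : V `<=` U).

Lemma sec_res_subproof (a : sec U) : sec_set V (one_on V * sec_val a).
Proof.
have [ne|e] := pselect (V !=set0); last first.
  by rewrite one_onF // mul0r; exact: sec_set0.
rewrite one_onT // mul1r; split=> [|y Vy]; first by left.
by case: (secP a) => _; apply; exact: h.
Qed.

(* The inclusion, except that it is 0 when V is empty. *)
Definition sec_res (a : sec U) : sec V := Sec (sec_res_subproof a).

Lemma sec_res_is_zmod_morphism : zmod_morphism sec_res.
Proof. by move=> a b; apply: sec_inj; exact: mulrBr. Qed.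

Lemma one_onM : one_on V * one_on U = one_on V.
Proof.
have [[y Vy]|e] := pselect (V !=set0); last by rewrite one_onF // mul0r.
by rewrite (one_onT (U := U)) ?mulr1 //; exists y; exact: h.
Qed.

Lemma one_on_idem (W : opens Y) : one_on W * one_on W = one_on W.
Proof. exact: sec_mul1 (sec_set1 W). Qed.

Lemma sec_res_is_monoid_morphism : monoid_morphism sec_res.
Proof.
split=> [|a b]; apply: sec_inj; first exact: one_onM.
by rewrite /sec_val /= mulrACA one_on_idem.
Qed.

HB.instance Definition _ := GRing.isZmodMorphism.Build (sec U) (sec V) sec_res
  sec_res_is_zmod_morphism.
HB.instance Definition _ := GRing.isMonoidMorphism.Build (sec U) (sec V) sec_res
  sec_res_is_monoid_morphism.

End Restriction.

Lemma sec_resE (U V : opens Y) (h : V `<=` U) (a : sec U) :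
  V !=set0 -> sec_val (sec_res h a) = sec_val a.
Proof. by move=> ne; rewrite /sec_val /= one_onT // mul1r. Qed.

Lemma sec_empty (U : opens Y) (a b : sec U) : ~ (U !=set0) -> a = b.
Proof.
move=> e; apply: sec_inj.
by case: (secP a) => -[//|->] _; case: (secP b) => -[//|->].
Qed.

Lemma sec_res_id (U : opens Y) (h : U `<=` U) (s : sec U) : sec_res h s = s.
Proof. by apply: sec_inj; apply: sec_mul1; exact: secP. Qed.

Lemma sec_res_res (U V W : opens Y) (h : V `<=` U) (k : W `<=` V)
  (l : W `<=` U) (s : sec U) : sec_res k (sec_res h s) = sec_res l s.
Proof.
by apply: sec_inj; rewrite /sec_val /= mulrA one_onM.
Qed.

Lemma sec_separated (U : opens Y) (I : Type) (V : I -> opens Y)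
  (h : forall i, V i `<=` U) : U `<=` \bigcup_i V i ->
  forall s t : sec U, (forall i, sec_res (h i) s = sec_res (h i) t) -> s = t.
Proof.
move=> cov s t e; have [[y Uy]|ne] := pselect (U !=set0); last exact: sec_empty.
have [i _ Viy] := cov y Uy; apply: sec_inj.
rewrite -(sec_resE (h i) s); last by exists y.
by rewrite e sec_resE //; exists y.
Qed.

Hypothesis Yinv : inverse_closed Y.

Lemma generic_in (y : Y) : exists eta : Y, forall U : opens Y, U !=set0 ->
  oset U eta.
Proof.
case: y => -[A XA0] /= /set_mem YA; have XA := set_mem XA0.
have [K XK KX] := lf_generic XA.
pose k : points X := exist _ K (mem_set XK).
have Yk : Y k.
  rewrite Yinv => U [oU _ YU]; apply: (open_up oU (YU _ YA)).
  exact: KX.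
exists (exist _ k (mem_set Yk)) => U [z Uz].
have [V oV VU] := open_oset U.
rewrite -VU /= in Uz *.
apply: (open_up oV Uz); apply: KX.
exact: ring_atP.
Qed.

Lemma sec_gluing (U : opens Y) (I : Type) (V : I -> opens Y)
  (h : forall i, V i `<=` U) : U `<=` \bigcup_i V i ->
  forall s : (forall i, sec (V i)),
    (forall i j (hi : opensI (V i) (V j) `<=` V i)
       (hj : opensI (V i) (V j) `<=` V j),
       sec_res hi (s i) = sec_res hj (s j)) ->
    exists t : sec U, forall i, sec_res (h i) t = s i.
Proof.
move=> cov s e; have [[y Uy]|ne] := pselect (U !=set0); last first.
  exists (sec_zero U) => i; apply: sec_empty => -[y Vy]; apply: ne.
  by exists y; exact: h Vy.
have [eta etaP] := generic_in y.
have [i0 _ Vi0] := cov y Uy.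
have eq i : V i !=set0 -> sec_val (s i) = sec_val (s i0).
  move=> ne.
  have neI : opensI (V i) (V i0) !=set0.
    by exists eta; split; apply: etaP => //; exists y.
  have kl : opensI (V i) (V i0) `<=` V i by apply: subIsetl.
  have kr : opensI (V i) (V i0) `<=` V i0 by apply: subIsetr.
  by rewrite -(sec_resE kl (s i) neI) (e _ _ kl kr) sec_resE.
have tP : sec_set U (sec_val (s i0)).
  split=> [|z Uz]; first by left; exists y.
  have [i _ Viz] := cov z Uz; rewrite -(eq i); last by exists z.
  by case: (secP (s i)) => _; exact.
exists (Sec tP) => i.
have [ne|ne] := pselect (V i !=set0); last exact: sec_empty.
by apply: sec_inj; rewrite sec_resE // eq.
Qed.

Definition inv_rs : ringed_space :=
  @RingedSpace Y (fun U => sec U) (fun U V h => sec_res h)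
    sec_res_id sec_res_res sec_separated sec_gluing.

Lemma open_ring_in (a : F) : open [set y : Y | ring_in y a].
Proof. by exists [set x | ring_at x a] => //; exact: open_mem. Qed.

Lemma germ_section (y : Y) (a : F) : ring_in y a ->
  exists (U : opens Y) (yU : oset U y) (s : sec U), sec_val s = a.
Proof.
move=> ya; exists (Opens (open_ring_in a)), ya.
have h : sec_set (Opens (open_ring_in a)) a by split=> //; left; exists y.
by exists (Sec h).
Qed.

Lemma germ_unit (y : inv_rs) (U : opens inv_rs) (yU : oset U y)
  (s : @sect inv_rs U) :
  unit_elt (germ yU s) <->
  exists2 b, ring_in y b & sec_val (s : sec U) * b = 1.
Proof.
split=> [[g]|[b yb sb]].
  case: (germ_surj2 (germ yU s) g) => V [yV [a [b [ea ->]]]].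
  rewrite ea -germM -(germ1 yV) => /germP[W [k [k' [Wy e]]]].
  have /germP[W' [l [l' [W'y e']]]] := ea.
  exists (sec_val (b : sec V)); first by case: (secP (b : sec V)) => _; exact.
  have ne : W !=set0 by exists y.
  have ne' : W' !=set0 by exists y.
  rewrite -(sec_resE l (s : sec U) ne').
  have -> : sec_res l (s : sec U) = sec_res l' (a : sec V) by [].
  rewrite sec_resE //.
  have := congr1 (@sec_val W) e.
  rewrite !(sec_resE _ _ ne) => eab; apply: etrans eab _.
  by rewrite /sec_val /= one_onT //; exists y.
have [V [yV [t tb]]] := germ_section yb.
exists (germ yV (t : @sect inv_rs V)).
pose W := opensI U V; have Wy : oset W y by [].
have WU : W `<=` U by apply: subIsetl.
have WV : W `<=` V by apply: subIsetr.
have ne : W !=set0 by exists y.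
rewrite -(germ_res yU Wy WU) -(germ_res yV Wy WV) -germM -(germ1 Wy).
congr germ; apply: sec_inj.
have -> : sec_val (res WU s * res WV t : sec W) =
  sec_val (sec_res WU s) * sec_val (sec_res WV t) by [].
by rewrite !sec_resE // tb sb /sec_val /= one_onT.
Qed.

Lemma inv_rs_local (y : inv_rs) : local_ring (stalk y).
Proof.
have [_ yD] := ring_in_local y.
have nu (U : opens inv_rs) (yU : oset U y) (s : @sect inv_rs U) :
    ~ unit_elt (germ yU s) <-> max_ideal (ring_in y) (sec_val (s : sec U)).
  split=> [n|[_ n] /germ_unit //].
  split; first by case: (secP (s : sec U)) => _; exact.
  by move=> /germ_unit.
apply: local_ring_nonunits => [[g]|g h].
  rewrite mul0r -(germ0 (X := inv_rs) (U := @topO _) I) -(germ1 (X := inv_rs) (U := @topO _) I).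
  move=> /germP[W [k [k' [Wy e]]]].
  have ne : W !=set0 by exists y.
  have := congr1 (@sec_val W) e; rewrite !(sec_resE _ _ ne).
  rewrite /sec_val /= one_onT; last by exists y.
  by move=> /esym/eqP; rewrite oner_eq0.
case: (germ_surj2 g h) => U [yU [s [t [-> ->]]]].
by rewrite -germD => /nu ms /nu mt; apply/nu; exact: yD.
Qed.

Definition inv_lrs : locally_ringed_space := LocallyRingedSpace inv_rs_local.

End InverseClosedSpace.

(* Valuation rings with quotient field [F]; recall that 0^-1 = 0. *)
Definition is_valuation_ring (F : fieldType) (V : set F) : Prop :=
  is_subring V /\ forall a, V a \/ V a^-1.

Definition zr_set (F : fieldType) (D : subringClosed F) : set (set F) :=
  [set V | is_valuation_ring V /\ [set` D] `<=` V].

Lemma subring0 (F : fieldType) (A : set F) : is_subring A -> A 0.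
Proof. by case=> A1 AB _; rewrite -(subrr 1); exact: AB. Qed.

Lemma subringN (F : fieldType) (A : set F) a : is_subring A -> A a -> A (- a).
Proof.
by move=> sA Aa; rewrite -sub0r; case: (sA) => _ AB _; apply: AB => //; exact: subring0.
Qed.

Lemma subringD (F : fieldType) (A : set F) a b :
  is_subring A -> A a -> A b -> A (a + b).
Proof.
move=> sA Aa Ab; rewrite -[b]opprK; case: (sA) => _ AB _; apply: AB => //.
exact: subringN.
Qed.

Lemma zr_local (F : fieldType) (D : subringClosed F) (V : set F) :
  zr_set D V -> is_local_subring V.
Proof.
case=> -[sV vV] _; split=> // a b [Va na] [Vb nb]; split; first exact: subringD.
have [V1 _ VM] := sV.
have aux x y : V x -> V y -> y != 0 -> V (x / y) ->
    ~ (exists2 c, V c & y * c = 1) -> ~ (exists2 c, V c & (x + y) * c = 1).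
  move=> Vx Vy y0 Vxy ny [c Vc e]; apply: ny; exists ((x / y + 1) * c).
    by apply: VM => //; exact: subringD.
  by rewrite mulrA mulrDr mulr1 mulrCA mulfV // mulr1.
have [->|a0] := eqVneq a 0; first by rewrite add0r.
have [->|b0] := eqVneq b 0; first by rewrite addr0.
have [Vab|] := vV (a / b); first exact: aux.
by rewrite invf_div => Vba; rewrite addrC; exact: aux.
Qed.

Lemma zr_generic (F : fieldType) (D : subringClosed F) (V : set F) :
  zr_set D V -> exists2 K, zr_set D K & forall B, zr_set D B -> B `<=` K.
Proof. by move=> _; exists setT => //; do ![split=> //]; left. Qed.

Definition zr_family (F : fieldType) (D : subringClosed F) : local_family F :=
  LocalFamily (@zr_local F D) (@zr_generic F D).

Definition ZR (F : fieldType) (D : subringClosed F) : topologicalType :=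
  points (zr_family D).

(* The prime ideals of a subring [R] of [F], as subsets of [F]. *)
Record prime_ideal (F : fieldType) (R p : set F) : Prop := PrimeIdeal {
  prime_sub : p `<=` R;
  prime0 : p 0;
  primeD : forall a b, p a -> p b -> p (a + b);
  primeM : forall r a, R r -> p a -> p (r * a);
  prime1 : ~ p 1;
  primeP : forall a b, R a -> R b -> p (a * b) -> p a \/ p b
}.

Definition localize (F : fieldType) (R p : set F) : set F :=
  [set x | exists a b, [/\ R a, R b, ~ p b & x = a / b]].

Definition adjoin (F : fieldType) (D : subringClosed F) (S : set F) : set F :=
  smallest (@is_subring F) ([set` D] `|` S).

Definition chart (F : fieldType) (D : subringClosed F) (n : nat)
    (f : 'I_n -> F) (i : 'I_n) : set F :=
  adjoin D [set f j / f i | j in [set: 'I_n]].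

(* A point is identified with its local ring, so that the charts are glued by
   taking their union as sets of subrings of [F]. *)
Definition model_set (F : fieldType) (D : subringClosed F) (n : nat)
    (f : 'I_n -> F) : set (set F) :=
  [set A | exists i p, prime_ideal (chart D f i) p /\
                       A = localize (chart D f i) p].

Record projective_model (F : fieldType) (D : subringClosed F) :=
  ProjectiveModel {
    pm_set : set (set F);
    pm_charts : exists (n : nat) (f : 'I_n -> F),
      [/\ (0 < n)%N, forall i, f i != 0 & pm_set = model_set D f]
  }.

Section Localization.
Variables (F : fieldType) (R p : set F).
Hypotheses (sR : is_subring R) (pp : prime_ideal R p).

Lemma localize_neq0 b : ~ p b -> b != 0.
Proof. by move=> nb; apply/eqP => b0; apply: nb; rewrite b0; exact: prime0 pp. Qed.

Lemma localize_denM b d : R b -> R d -> ~ p b -> ~ p d -> ~ p (b * d).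
Proof. by move=> Rb Rd nb nd /(primeP pp Rb Rd) []. Qed.

Lemma localize_subring : is_subring (localize R p).
Proof.
have [R1 RB RM] := sR; have n1 := prime1 pp.
split; first by exists 1, 1; split=> //; rewrite divr1.
  move=> _ _ [a [b [Ra Rb nb ->]]] [c [d [Rc Rd nd ->]]].
  exists (a * d - c * b), (b * d); split=> //.
  - by apply: RB; exact: RM.
  - exact: RM.
  - exact: localize_denM.
  - by rewrite -mulNr addf_div ?localize_neq0 // mulNr.
move=> _ _ [a [b [Ra Rb nb ->]]] [c [d [Rc Rd nd ->]]].
exists (a * c), (b * d); split; try exact: RM; first exact: localize_denM.
by rewrite mulf_div.
Qed.

Lemma max_ideal_localize x : max_ideal (localize R p) x <->
  exists a b, [/\ p a, R b, ~ p b & x = a / b].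
Proof.
split=> [[[a [b [Ra Rb nb ->]]] nu]|[a [b [pa Rb nb ->]]]].
  exists a, b; split=> //; apply: contrapT => na; apply: nu.
  exists (b / a); first by exists b, a.
  by rewrite mulf_div [b * a]mulrC divff // mulf_neq0 // localize_neq0.
have Ra := prime_sub pp pa.
split; first by exists a, b.
case=> _ [c [d [Rc Rd nd ->]]]; rewrite mulf_div => e.
apply: (localize_denM Rb Rd nb nd).
have bd0 : b * d != 0 by rewrite mulf_neq0 // localize_neq0.
rewrite -[b * d]mul1r -e divfK // mulrC; exact: (primeM pp).
Qed.

Lemma localize_local : is_local_subring (localize R p).
Proof.
have [R1 RB RM] := sR.
split=> [|x y]; first exact: localize_subring.
move=> /max_ideal_localize[a [b [pa Rb nb ->]]].
move=> /max_ideal_localize[c [d [pc Rd nd ->]]].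
apply/max_ideal_localize; exists (a * d + c * b), (b * d); split.
- by apply: (primeD pp); rewrite mulrC; exact: (primeM pp).
- exact: RM.
- exact: localize_denM.
- by rewrite addf_div ?localize_neq0.
Qed.

End Localization.

Lemma prime_zero (F : fieldType) (R : set F) :
  is_subring R -> prime_ideal R [set 0].
Proof.
move=> sR; split=> //=.
- by move=> _ ->; exact: subring0.
- by move=> _ _ -> ->; rewrite addr0.
- by move=> r _ _ ->; rewrite mulr0.
- by apply/eqP; exact: oner_neq0.
- by move=> a b _ _ /eqP; rewrite mulf_eq0 => /orP[] /eqP; [left|right].
Qed.

Lemma adjoin_subring (F : fieldType) (D : subringClosed F) (S : set F) :
  is_subring (adjoin D S).
Proof.
split=> [A [[]]//|a b Da Db A hA|a b Da Db A hA]; have [[A1 AB AM] _] := hA.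
  by apply: AB; [exact: Da|exact: Db].
by apply: AM; [exact: Da|exact: Db].
Qed.

Section Model.
Variables (F : fieldType) (D : subringClosed F).

Lemma chart_gen (n : nat) (f : 'I_n -> F) i j : chart D f i (f j / f i).
Proof. by move=> A [_]; apply; right; exists j. Qed.

Lemma chart_base (n : nat) (f : 'I_n -> F) i : [set` D] `<=` chart D f i.
Proof. by move=> a Da A [_]; apply; left. Qed.

Lemma model_local (X : projective_model D) A : pm_set X A -> is_local_subring A.
Proof.
case: X => X [n [f [n0 f0 XE]]] /=; rewrite XE => -[i [p [pp ->]]].
exact: localize_local (adjoin_subring _ _) pp.
Qed.

Lemma model_generic (X : projective_model D) A : pm_set X A ->
  exists2 K, pm_set X K & forall B, pm_set X B -> B `<=` K.
Proof.
case: X => X [n [f [n0 f0 XE]]] /=; rewrite XE => -[i _].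
have sR j : is_subring (chart D f j) by exact: adjoin_subring.
have pz := prime_zero (sR i).
exists (localize (chart D f i) [set 0]); first by exists i, [set 0].
have sK := localize_subring (sR i) pz.
have Kdiv a b : localize (chart D f i) [set 0] a ->
    localize (chart D f i) [set 0] b -> b != 0 ->
    localize (chart D f i) [set 0] (a / b).
  have [_ _ RM] := sR i.
  move=> [u [v [Ru Rv v0 ->]]] [w [z [Rw Rz z0 ->]]] wz0.
  exists (u * z), (v * w); split; try exact: RM.
    have w0 : w <> 0 by move=> w0; rewrite w0 mul0r eqxx in wz0.
    by move=> /eqP; rewrite mulf_eq0 => /orP[] /eqP.
  by rewrite invf_div mulf_div.
have RK : chart D f i `<=` localize (chart D f i) [set 0].
  move=> a Ra; exists a, 1; split=> //; [by case: (sR i)| |by rewrite divr1].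
  exact: prime1 pz.
move=> _ [j [q [pq ->]]].
have jK : chart D f j `<=` localize (chart D f i) [set 0].
  apply: smallest_sub => // a [Da|[k _ <-]]; first by apply: RK; exact: chart_base.
  have -> : f k / f j = (f k / f i) / (f j / f i).
    by rewrite invf_div mulrA divfK.
  apply: Kdiv; try (apply: RK; exact: chart_gen).
  by rewrite mulf_neq0 // invr_eq0.
move=> _ [a [b [Ra Rb nb ->]]]; apply: Kdiv; [exact: jK|exact: jK|].
exact: localize_neq0 pq _ nb.
Qed.

Definition pm_family (X : projective_model D) : local_family F :=
  LocalFamily (@model_local X) (@model_generic X).

Definition dominates (Y X : projective_model D) : Prop :=
  forall B, pm_set Y B -> exists2 A, pm_set X A & centered B A.

Definition dominant_system (S : set (projective_model D)) : Prop :=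
  forall X Y : projective_model D,
    exists2 W, S W & dominates W X /\ dominates W Y.

Definition centers (Z : set (ZR D)) (X : projective_model D) :
    set (points (pm_family X)) :=
  [set x | exists2 V, Z V & centered (ring_at V) (ring_at x)].

Definition inv_zr (Z : set (ZR D)) : locally_ringed_space :=
  inv_lrs (inv_inverse_closed Z).

Definition inv_centers (Z : set (ZR D)) (X : projective_model D) :
    locally_ringed_space :=
  inv_lrs (inv_inverse_closed (@centers Z X)).

Definition member (S : set (projective_model D)) (X : S) :
  projective_model D := \val X.

End Model.

(* The map sends each local ring to the one that it dominates, and the maps of
   sections are inclusions of subrings of [F], apart from sections over the
   empty set, which form the zero ring. *)
Definition is_domination (F : fieldType) (X1 X2 : local_family F)
    (Y1 : set (points X1)) (Y2 : set (points X2))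
    (h1 : inverse_closed Y1) (h2 : inverse_closed Y2)
    (phi : lrs_mor (inv_lrs h1) (inv_lrs h2)) : Prop :=
  (forall y : Y1, centered (ring_in y) (ring_in (phi y : Y2))) /\
  forall (U : opens Y2) (s : sec U),
    preim_opens (mor_cont phi) U !=set0 ->
    sec_val (mor_sharp phi U s : sec (preim_opens (mor_cont phi) U)) =
    sec_val s.

(* Main.v *)
(** A point [z] of a cone over the system determines the directed union of the
    local rings of its images.  Every [a] in [F] gives a projective model whose
    two charts contain [a] and [a^-1], and some member of the system dominates
    it; so the union is a valuation ring, and it is the only one centered on
    all the images of [z].

    That it lies in [inv Z] rests on the center map from the Zariski-Riemann
    space to a model.  This map is surjective, since every local subring of [F]
    is dominated by a valuation ring, and preimages of quasicompact open sets
    are quasicompact open, as an ultrafilter on the Zariski-Riemann space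
    converges to the valuation ring of the [a] that belong to almost every
    point.  A quasicompact open set of the Zariski-Riemann space is defined by
    finitely many elements of [F], hence is the preimage of a quasicompact open
    set of some member of the system.

    Sections are elements of [F], so that the map of sections is glued from the
    maps of sections of the cone. *)

From HB Require Import structures.
Require Import Defs.
From mathcomp Require Import all_boot all_order all_algebra.
From mathcomp Require Import finmap boolp classical_sets topology zify.

Set Implicit Arguments.
Unset Strict Implicit.
Unset Printing Implicit Defensive.

Import GRing.Theory.

Local Open Scope classical_set_scope.
Local Open Scope ring_scope.

(** * Local subrings of a field *)

Section LocalSubrings.

Variable F : fieldType.
Implicit Types A B C R : set F.

Lemma subring_exp R a n : is_subring R -> R a -> R (a ^+ n).
Proof.
move=> [R1 _ RM] Ra; elim: n => [|n IHn]; first by rewrite expr0.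
by rewrite exprS; exact: RM.
Qed.

Lemma max_idealM A r m : is_subring A -> A r -> max_ideal A m ->
  max_ideal A (r * m).
Proof.
move=> [_ _ AM] Ar [Am nm]; split; first exact: AM.
move=> [c Ac e]; apply: nm; exists (r * c); first exact: AM.
by rewrite mulrCA mulrA.
Qed.

Lemma max_ideal0 A : is_subring A -> max_ideal A 0.
Proof.
move=> sA; split; first exact: subring0.
by move=> [c _]; rewrite mul0r => /esym/eqP; rewrite oner_eq0.
Qed.

Lemma unit_subring A a : A a -> ~ max_ideal A a -> a != 0 /\ A a^-1.
Proof.
move=> Aa na; have [c Ac e] : exists2 c, A c & a * c = 1.
  by apply: contrapT => h; apply: na.
have a0 : a != 0.
  by apply: contra_eqN e => /eqP ->; rewrite mul0r eq_sym oner_eq0.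
by split => //; have -> : a^-1 = c by rewrite -[LHS]mulr1 -e mulKf.
Qed.

Lemma centered_trans A B C : centered C B -> centered B A -> centered C A.
Proof.
move=> [BC mB] [AB mA]; split; first exact: subset_trans BC.
by rewrite mA mB -setIA (setIidr AB).
Qed.

(** A nonzero non-unit of [A] stays a non-unit in [B]; the case [a = 0] is the convention that the
    inverse of 0 is 0. Domination is mostly used in this form. *)
Lemma centered_inv A B a : centered B A -> A a -> B a^-1 -> A a^-1.
Proof.
move=> [AB mA] Aa Ba; have [a0|a0] := eqVneq a 0; first by rewrite a0 invr0 -a0.
have : ~ max_ideal A a.
  by rewrite mA => -[[_ h] _]; apply: h; exists a^-1 => //; rewrite mulfV.
by case/(unit_subring Aa).
Qed.

Lemma centered_intro A B : A `<=` B ->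
  (forall a, A a -> a != 0 -> B a^-1 -> A a^-1) -> centered B A.
Proof.
move=> AB h; split => //; apply/seteqP; split=> a.
  move=> [Aa na]; split => //; split; first exact: AB.
  move=> [b Bb e]; apply: na; exists b => //.
  have a0 : a != 0.
    by apply: contra_eqN e => /eqP ->; rewrite mul0r eq_sym oner_eq0.
  have eb : b = a^-1 by rewrite -[RHS]mulr1 -e mulKf.
  by rewrite eb in Bb *; exact: h.
by move=> [[Ba na] Aa]; split => // -[b Ab e]; apply: na; exists b => //; exact: AB.
Qed.

(** Elements of [R] outside the contraction are units of [A], and a product of units is a unit. *)
Lemma center_prime A R : is_local_subring A -> is_subring R -> R `<=` A ->
  prime_ideal R (max_ideal A `&` R).
Proof.
move=> [sA DA] [R1 RB RM] RA; have sR : is_subring R by [].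
split.
- by move=> a [].
- by split; [exact: max_ideal0|exact: subring0].
- by move=> a b [ma Ra] [mb Rb]; split; [exact: DA|exact: subringD].
- by move=> r a Rr [ma Ra]; split; [apply: max_idealM => //; exact: RA|exact: RM].
- by move=> [[_ h] _]; apply: h; exists 1; [exact: RA|rewrite mulr1].
move=> a b Ra Rb [mab _]; apply: contrapT => /not_orP[na nb].
have [a0 Aa] : a != 0 /\ A a^-1.
  by apply: unit_subring; [exact: RA|move=> ma; apply: na].
have [b0 Ab] : b != 0 /\ A b^-1.
  by apply: unit_subring; [exact: RA|move=> ma; apply: nb].
case: mab => _; apply; exists (a^-1 * b^-1); first by case: sA => _ _; apply.
by rewrite mulrACA !mulfV // mulr1.
Qed.

(** The denominators are units of [A], so the localization lies in [A]. If the inverse of [a / b]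
    lies in [A], then [a] is a unit of [A] and may serve as a denominator. *)
Lemma centered_localize A R : is_local_subring A -> is_subring R -> R `<=` A ->
  centered A (localize R (max_ideal A `&` R)).
Proof.
move=> lA sR RA; have pp := center_prime lA sR RA.
have sA : is_subring A by case: lA.
have [_ _ AM] := sA.
have unitR b : R b -> ~ (max_ideal A `&` R) b -> b != 0 /\ A b^-1.
  by move=> Rb nb; apply: (unit_subring (RA _ Rb)) => m; exact: nb.
apply: centered_intro.
  move=> _ [a [b [Ra Rb /unitR[//|b0 Ab] ->]]].
  by apply: AM => //; exact: RA.
move=> _ [a [b [Ra Rb nb ->]]] ab0; rewrite invf_div => Aba.
exists b, a; split => // -[[_ h] _]; apply: h; exists (b / a * b^-1).
  by apply: AM => //; case: (unitR b).
have [b0 _] := unitR b Rb nb.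
have a0 : a != 0 by apply: contra_neq ab0 => ->; rewrite mul0r.
by rewrite mulrAC mulfV // mul1r mulfV.
Qed.

End LocalSubrings.

(** * Domination by valuation rings *)

Section Chevalley.

Variable F : fieldType.
Implicit Types (R M : set F) (p q : {poly F}).

(** For a ring [R], the ideal [M R] of finite sums of products, set up for induction on the number
    of terms. *)
Inductive ideal_gen M R : set F :=
| ideal_gen0 : ideal_gen M R 0
| ideal_genD m r x : M m -> R r -> ideal_gen M R x ->
    ideal_gen M R (m * r + x).

Lemma ideal_gen_add M R x y :
  ideal_gen M R x -> ideal_gen M R y -> ideal_gen M R (x + y).
Proof.
move=> Ix Iy; elim: Ix => [|m r z Mm Rr _ IH]; first by rewrite add0r.
by rewrite -addrA; exact: ideal_genD.
Qed.

Lemma ideal_gen_mul M R x r : is_subring R ->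
  R r -> ideal_gen M R x -> ideal_gen M R (r * x).
Proof.
move=> [_ _ RM] Rr; elim=> [|m s y Mm Rs _ IH].
  by rewrite mulr0; exact: ideal_gen0.
by rewrite mulrDr mulrCA; apply: ideal_genD => //; exact: RM.
Qed.

Lemma ideal_gen_sub M R R' : R `<=` R' -> ideal_gen M R `<=` ideal_gen M R'.
Proof.
move=> RR x; elim=> [|m s y Mm /RR Rs _ IH]; first exact: ideal_gen0.
exact: ideal_genD.
Qed.

Lemma ideal_gen_subring M R : is_subring R -> M `<=` R ->
  ideal_gen M R `<=` R.
Proof.
move=> sR MR x; elim=> [|m s y /MR Mm Rs _ IH]; first exact: subring0.
by apply: subringD => //; case: sR => _ _; apply.
Qed.

(** Membership involves only finitely many elements of the union, and these lie in one member of the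
    chain. *)
Lemma ideal_gen_directed M (G : set (set F)) x : G !=set0 ->
  total_on G subset -> ideal_gen M (\bigcup_(R in G) R) x ->
  exists2 R, G R & ideal_gen M R x.
Proof.
move=> [R0 GR0] tG; elim=> [|m r y Mm [R1 GR1 R1r] _ [R2 GR2 Iy]].
  by exists R0 => //; exact: ideal_gen0.
have [R12|R21] := tG _ _ GR1 GR2.
  by exists R2 => //; apply: ideal_genD => //; exact: R12.
by exists R1 => //; apply: ideal_genD => //; exact: ideal_gen_sub Iy.
Qed.

Definition coefs_in R p := forall i, R p`_i.

(** For a ring [R] this is the ring generated by [x] over [R]; applied to an ideal of [R], it is the
    extension of the ideal to that ring. *)
Definition adjoin1 R x : set F := [set p.[x] | p in coefs_in R].

Lemma coefs_inC R c : R 0 -> R c -> coefs_in R c%:P.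
Proof. by move=> R0 Rc i; rewrite coefC; case: ifP. Qed.

Lemma adjoin1_base R x : is_subring R -> R `<=` adjoin1 R x.
Proof.
move=> sR a Ra; exists a%:P; last by rewrite hornerC.
by apply: coefs_inC => //; exact: subring0.
Qed.

Lemma adjoin1_gen R x : is_subring R -> adjoin1 R x x.
Proof.
move=> sR; exists 'X; last by rewrite hornerX.
by move=> i; rewrite coefX; case: eqP => _ /=; [case: sR|exact: subring0].
Qed.

Lemma adjoin1_subring R x : is_subring R -> is_subring (adjoin1 R x).
Proof.
move=> sR; split; first by apply: adjoin1_base => //; case: sR.
  move=> _ _ [p Rp <-] [q Rq <-]; exists (p - q); last by rewrite !hornerE.
  by move=> i; rewrite coefB; case: sR => _ + _; apply.
move=> _ _ [p Rp <-] [q Rq <-]; exists (p * q); last by rewrite hornerM.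
move=> i; rewrite coefM; apply: big_ind; first exact: subring0.
  by move=> a b; exact: subringD.
by move=> j _; case: sR => _ _; apply.
Qed.

(** Collecting powers of [x] turns membership of 1 in the extended ideal into a polynomial relation
    with coefficients in [ideal_gen M R]. *)
Lemma ideal_gen_adjoin1 M R x : is_subring R ->
  ideal_gen M (adjoin1 R x) `<=` adjoin1 (ideal_gen M R) x.
Proof.
move=> sR y; elim=> [|m _ z Mm [p Rp <-] _ [q Iq <-]].
  exists 0; last by rewrite horner0.
  by move=> i; rewrite coef0; exact: ideal_gen0.
exists (m *: p + q); last by rewrite !hornerE.
by move=> i; rewrite coefD coefZ; apply: ideal_genD; [|exact: Rp|exact: Iq].
Qed.

(* Solving the relation for [x^-1] for [x ^+ m] and substituting the result in
   the relation for [x] lowers the degree of the latter. *)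
Lemma no_two_relations M R x : is_subring R -> M `<=` R ->
  ~ ideal_gen M R 1 ->
  (forall v, ideal_gen M R v -> 1 - v != 0 /\ R (1 - v)^-1) ->
  x != 0 -> adjoin1 (ideal_gen M R) x 1 ->
  ~ adjoin1 (ideal_gen M R) x^-1 1.
Proof.
move=> sR MR n1 U x0 [p Ip px] [q Iq qx].
have [n] := ubnP (size p + size q).
elim: n x x0 p Ip px q Iq qx => // n IH x x0 p Ip px q Iq qx.
(* Replacing [x] by its inverse exchanges the two relations. *)
wlog le_qp : x x0 p Ip px q Iq qx / (size q <= size p)%N => [wl|].
  have [|/ltnW le] := leqP (size q) (size p); first exact: (wl x x0 p Ip px q Iq qx).
  by rewrite addnC; apply: (wl x^-1 _ q Iq qx p Ip); rewrite ?invr_eq0 ?invrK.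
(* A constant relation would put 1 in the ideal. *)
have [p1|p1] := leqP (size p) 1.
  by move=> _; apply: n1; rewrite -px (size1_polyC p1) hornerC; exact: Ip.
move Em : (size p).-1 => m; have sp : size p = m.+1 by lia.
have m0 : (0 < m)%N by lia.
rewrite ltnS => le_n.
have sq : (size q <= m.+1)%N by rewrite -sp.
(* Multiplying the relation for the inverse by the power [x ^+ m] expresses that power times 1 - q_0
   as the sum of the q_(m-i) x^i for i < m; [w] times this sum replaces the leading term of [p]. *)
pose w := p`_m * (1 - q`_0)^-1.
have [q0 Rq0] := U _ (Iq 0%N).
pose p' := \poly_(i < m) (p`_i + w * q`_(m - i)).
have Ip' : coefs_in (ideal_gen M R) p'.
  move=> i; rewrite coef_poly; case: ifP => _; last exact: ideal_gen0.
  apply: ideal_gen_add => //; apply: ideal_gen_mul => //.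
  case: (sR) => _ _; apply => //; exact: ideal_gen_subring (Ip m).
apply: (IH x x0 p' Ip' _ q Iq qx).
  have -> : p'.[x] = \sum_(i < m) p`_i * x ^+ i +
      w * \sum_(i < m) q`_(m - i) * x ^+ i.
    rewrite horner_poly big_distrr -big_split /=; apply: eq_bigr => i _.
    by rewrite mulrDl mulrA.
  have <- : x ^+ m * (1 - q`_0) = \sum_(i < m) q`_(m - i) * x ^+ i.
    rewrite -{1}qx (horner_coef_wide _ sq) big_ord_recl /= expr0 mulr1.
    rewrite addrC addKr big_distrr (reindex_inj rev_ord_inj) /=.
    apply: eq_bigr => i _; rewrite /bump /= add1n.
    have -> : (m - i.+1).+1 = (m - i)%N by have := ltn_ord i; lia.
    rewrite mulrCA; congr (_ * _); rewrite exprVn.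
    have {1}-> : m = (i + (m - i))%N by have := ltn_ord i; lia.
    by rewrite exprD mulfK // expf_neq0.
  rewrite -[RHS]px horner_coef sp big_ord_recr /=; congr (_ + _).
  by rewrite /w mulrACA mulVf // mulr1.
have : (size p' <= m)%N by exact: size_poly.
by lia.
Qed.

End Chevalley.

Section Domination.

Variable F : fieldType.
Implicit Types (A R M : set F) (p : {poly F}).

Lemma directed_subring (G : set (set F)) : G !=set0 ->
  (forall R R', G R -> G R' -> exists2 R'', G R'' & R `|` R' `<=` R'') ->
  (forall R, G R -> is_subring R) -> is_subring (\bigcup_(R in G) R).
Proof.
move=> [R GR] dG sG; split; first by exists R => //; case: (sG _ GR).
  move=> a b [R1 /dG h /= Ra] [R2 /h[R3 GR3 sub] Rb]; exists R3 => //.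
  by case: (sG _ GR3) => _ + _; apply; apply: sub; [left|right].
move=> a b [R1 /dG h /= Ra] [R2 /h[R3 GR3 sub] Rb]; exists R3 => //.
by case: (sG _ GR3) => _ _; apply; apply: sub; [left|right].
Qed.

(** Clearing denominators in a relation for the inverse of [1 - v] puts a power of [1 - v] in the
    ideal, and this power is congruent to 1 modulo [v]. *)
Lemma invert_one_sub M R v : is_subring R -> ideal_gen M R `<=` R ->
  ~ ideal_gen M R 1 -> ideal_gen M R v ->
  ~ ideal_gen M (adjoin1 R (1 - v)^-1) 1.
Proof.
move=> sR IR n1 Iv /(ideal_gen_adjoin1 sR)[p Ip]; set u := 1 - v => pu.
have u0 : u != 0 by rewrite subr_eq0; apply/eqP => e; rewrite e in n1.
have Ru : R u by case: (sR) => R1 RB _; apply: RB => //; exact: IR.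
pose n := size p.
have Isum (G : 'I_n -> F) : (forall i, ideal_gen M R (G i)) ->
    ideal_gen M R (\sum_(i < n) G i).
  move=> h; apply: big_ind => //; first exact: ideal_gen0.
  exact: ideal_gen_add.
have Iun : ideal_gen M R (u ^+ n).
  have -> : u ^+ n = \sum_(i < n) u ^+ (n - i) * p`_i.
    rewrite -[LHS]mulr1 -pu horner_coef big_distrr /=; apply: eq_bigr => i _.
    rewrite exprVn mulrCA mulrC; congr (_ * _).
    have {1}-> : n = (n - i + i)%N by rewrite subnK // ltnW.
    by rewrite exprD mulfK // expf_neq0.
  by apply: Isum => i; apply: ideal_gen_mul => //; exact: subring_exp.
(* The geometric sum, with [v = 1 - u]. *)
apply: n1; have -> : 1 = u ^+ n + (\sum_(i < n) u ^+ i) * v.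
  rewrite -{1}(subrK (u ^+ n) 1) addrC; congr (_ + _).
  have -> : v = 1 - u by rewrite /u opprB addrC subrK.
  by rewrite -[LHS]opprB subrX1 -mulNr opprB mulrC.
apply: ideal_gen_add => //; apply: ideal_gen_mul => //.
apply: big_ind; first exact: subring0.
  by move=> a b; exact: subringD.
by move=> i _; exact: subring_exp.
Qed.

(** Take [R] maximal among the rings containing [A] in which [M] does not generate 1. Each [x]
    outside [R] satisfies a relation by maximality, and [x] and its inverse cannot both do so. An
    element of [M] invertible in [R] would put 1 in the ideal, whence domination. *)
Lemma dominating_valuation_ring A : is_local_subring A ->
  exists V, is_valuation_ring V /\ centered V A.
Proof.
move=> [sA DA]; pose M := max_ideal A.
pose good R := [/\ is_subring R, A `<=` R & ~ ideal_gen M R 1].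
have MA : M `<=` A by move=> a [].
have M1 m : M m -> A m^-1 -> m != 0 -> False.
  by move=> [_ h] Am m0; apply: h; exists m^-1 => //; rewrite mulfV.
have goodA : good A.
  split=> // h.
  suff /(_ 1 h)[_] : ideal_gen M A `<=` M.
    by apply; exists 1; [case: sA|rewrite mulr1].
  move=> x; elim=> [|m r y Mm Ar _ My]; first exact: max_ideal0.
  by apply: DA => //; rewrite mulrC; exact: max_idealM.
have [G GP tG|R [PR Rmax]] :=
    @Zorn_bigcup F [set R | R = set0 \/ good R].
  have [->|/set0P[x [R0 GR0 R0x]]] := eqVneq (\bigcup_(R in G) R) set0.
    by left.
  right.
  have gG R : G R -> R !=set0 -> good R.
    by move=> /GP[->|//] [].
  pose G' := [set R | G R /\ good R].
  have G'0 : G' !=set0 by exists R0; split => //; apply: gG => //; exists x.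
  have -> : \bigcup_(R in G) R = \bigcup_(R in G') R.
    apply/seteqP; split=> [y [R GR Ry]|y [R [GR _] Ry]]; exists R => //.
    by split => //; apply: gG => //; exists y.
  have tG' : total_on G' subset by move=> R R' [GR _] [GR' _]; exact: tG.
  split.
  - apply: directed_subring => //; last by move=> R [_ []].
    move=> R R' GR GR'; have [RR|RR] := tG' _ _ GR GR'; [exists R'|exists R] => //.
      by move=> y [/RR|].
    by move=> y [|/RR].
  - by move=> y Ay; have [R [GR gR]] := G'0; exists R => //; case: gR => _ + _; apply.
  - by move=> /(ideal_gen_directed G'0 tG')[R [_ [_ _]]].
have {}PR : good R.
  case: PR => // R0; exfalso; apply: (Rmax A); last by right.
  rewrite R0; split => // h; have [+ _ _] := sA; exact: h.
have [sR AR n1] := PR.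
have {}Rmax B : is_subring B -> R `<=` B -> ~ ideal_gen M B 1 -> B `<=` R.
  move=> sB RB nB; apply: contrapT => BR; apply: (Rmax B) => //.
  by right; split => //; exact: subset_trans RB.
have MR : M `<=` R by exact: subset_trans AR.
have IR := ideal_gen_subring sR MR.
have adj x : ~ R x -> adjoin1 (ideal_gen M R) x 1.
  move=> Rx; apply: (ideal_gen_adjoin1 sR); apply: contrapT => n.
  apply: Rx; apply: (Rmax (adjoin1 R x)) => //; [exact: adjoin1_subring| |].
    exact: adjoin1_base.
  exact: adjoin1_gen.
have U v : ideal_gen M R v -> 1 - v != 0 /\ R (1 - v)^-1.
  move=> Iv; split; first by rewrite subr_eq0; apply/eqP => e; rewrite e in n1.
  apply: (Rmax (adjoin1 R (1 - v)^-1)); [exact: adjoin1_subring| | |].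
  - exact: adjoin1_base.
  - exact: invert_one_sub.
  - exact: adjoin1_gen.
exists R; split.
  split => // x; have [->|x0] := eqVneq x 0; first by left; exact: subring0.
  apply: contrapT => /not_orP[nx nx']; apply: (no_two_relations sR MR n1 U x0).
    exact: adj.
  exact: adj.
apply: centered_intro => // a Aa a0 Ra; apply: contrapT => Aa'; apply: n1.
rewrite -(mulfV a0) -[_ * _]addr0; apply: ideal_genD => //; last exact: ideal_gen0.
by apply: contrapT => /(unit_subring Aa)[].
Qed.

End Domination.

(** * Centers on projective models *)

Section Centers.

Variables (F : fieldType) (D : subringClosed F).
Implicit Types (A B V O : set F) (X : projective_model D).

Lemma chart_sub n (f : 'I_n -> F) i A : is_subring A -> [set` D] `<=` A ->
  (forall j, A (f j / f i)) -> chart D f i `<=` A.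
Proof.
move=> sA DA fA; apply: smallest_sub => // a [/DA//|[j _ <-]]; exact: fA.
Qed.

Lemma model_base X A : pm_set X A -> [set` D] `<=` A.
Proof.
case: X => S [n [f [_ _ /= ->]]] [i [p [pp ->]]] a Da.
exists a, 1; split; [exact: chart_base| |exact: prime1 pp|by rewrite divr1].
by case: (adjoin_subring D [set f j / f i | j in [set: 'I_n]]).
Qed.

Lemma localize_base (R p : set F) : is_subring R -> prime_ideal R p ->
  R `<=` localize R p.
Proof.
move=> [R1 _ _] pp a Ra; exists a, 1.
by split => //; [exact: prime1 pp|rewrite divr1].
Qed.

(** The center is the localization of the chart at the contraction of the maximal ideal of [O]. *)
Lemma chart_center_model X n (f : 'I_n -> F) i O : pm_set X = model_set D f ->
  is_local_subring O -> chart D f i `<=` O ->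
  exists2 A, pm_set X A & [/\ centered O A, chart D f i `<=` A &
    forall a, chart D f i a -> O a^-1 -> A a^-1].
Proof.
move=> EX lO CO; set R := chart D f i in CO *.
have sR : is_subring R by exact: adjoin_subring.
have cA := centered_localize lO sR CO.
exists (localize R (max_ideal O `&` R)).
  rewrite EX; exists i, (max_ideal O `&` R); split => //.
  exact: center_prime.
have RA := localize_base sR (center_prime lO sR CO).
by split => // a Ra; apply: centered_inv cA _; exact: RA.
Qed.

(* The ratios [f j / f i] generating a chart through [A] are units at the
   common center of [A] and [B], so that [A] contains the charts through [B]. *)
Lemma center_unique X O A B : pm_set X A -> pm_set X B ->
  centered O A -> centered O B -> A = B.
Proof.
have [n [f [n0 f0 EX]]] := pm_charts X.
suff sub A' B' : pm_set X A' -> pm_set X B' ->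
    centered O A' -> centered O B' -> B' `<=` A'.
  by move=> XA XB OA OB; apply/seteqP; split; exact: sub.
move=> XA XB OA OB.
have [sA _] := model_local XA; have [A1 _ AM] := sA.
have DA := model_base XA.
move: XA XB; rewrite EX => -[i [p [pp EA]]] [j [q [pq EB]]].
have RA : chart D f i `<=` A'.
  by rewrite EA; apply: localize_base => //; exact: adjoin_subring.
have RB : chart D f j `<=` B'.
  by rewrite EB; apply: localize_base => //; exact: adjoin_subring.
have Aij : A' (f j / f i)^-1.
  apply: (centered_inv OA); first by apply: RA; exact: chart_gen.
  rewrite invf_div; case: OB => BO _; apply: BO; apply: RB; exact: chart_gen.
have jA : chart D f j `<=` A'.
  apply: chart_sub => // k.
  have -> : f k / f j = (f k / f i) * (f j / f i)^-1.
    by rewrite invf_div mulrA divfK.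
  by apply: AM => //; apply: RA; exact: chart_gen.
rewrite {1}EB => _ [a [b [Ra Rb nb ->]]]; apply: AM; first exact: jA.
apply: (centered_inv OA); first exact: jA.
case: OB => BO _; apply: BO; rewrite EB; exists 1, b; split => //.
  by case: (adjoin_subring D [set f k / f j | k in [set: 'I_n]]).
by rewrite mul1r.
Qed.

(** Divisibility with respect to a valuation ring is total, so one of finitely many nonzero elements
    divides all the others. *)
Lemma valuation_divisor V n (f : 'I_n -> F) : is_valuation_ring V ->
  (0 < n)%N -> (forall i, f i != 0) -> exists i, forall j, V (f j / f i).
Proof.
move=> [[V1 _ VM] vV] n0 f0.
suff [i h] : exists i, forall j, j \in enum 'I_n -> V (f j / f i).
  by exists i => j; apply: h; rewrite mem_enum.
elim: (enum _) => [|k s [i IH]]; first by exists (Ordinal n0).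
have [Vk|] := vV (f k / f i).
  by exists i => j; rewrite inE => /predU1P[->//|]; exact: IH.
rewrite invf_div => Vk; exists k => j; rewrite inE => /predU1P[->|js].
  by rewrite divff.
have -> : f j / f k = (f j / f i) * (f i / f k) by rewrite mulrA divfK.
by apply: VM => //; exact: IH.
Qed.

(** Dividing by a coordinate that divides all the others gives a chart contained in [V]. *)
Lemma center_exists X V : zr_set D V -> exists2 A, pm_set X A & centered V A.
Proof.
move=> zV; have lV := zr_local zV; case: zV => vV DV.
have [n [f [n0 f0 EX]]] := pm_charts X.
have [i fV] := valuation_divisor vV n0 f0.
have [A XA [cA _ _]] := chart_center_model EX lV (chart_sub vV.1 DV fV).
by exists A.
Qed.

(* Take for [T] the generators of a chart at [x] and the inverses of the
   denominators of finitely many elements that define a neighborhood of [x]. *)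
Lemma open_center_nbhd X (U : set (points (pm_family X))) x : open U -> U x ->
  exists T : {fset F}, [set` T] `<=` ring_at x /\
    forall O y, is_local_subring O -> [set` T] `<=` O ->
      centered O (ring_at y) -> U y.
Proof.
move=> /open_basicP oU /oU[S Sx SU].
have [n [f [n0 f0 EX]]] := pm_charts X.
have := ring_atP x; rewrite /= EX => -[i [p [pp Ex]]].
set R := chart D f i in pp Ex.
have sR : is_subring R by exact: adjoin_subring.
have Rx : R `<=` ring_at x by rewrite Ex; exact: localize_base.
have /choice[d dP] a : exists b, ring_at x a -> [/\ R b, R (a * b), b != 0 & ~ p b].
  have [|na] := pselect (ring_at x a); last by exists 0.
  rewrite Ex => -[u [b [Ru Rb nb ->]]]; exists b => _.
  by rewrite divfK ?(localize_neq0 pp nb).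
exists ([fset f j / f i | j : 'I_n] `|` [fset (d a)^-1 | a in S])%fset; split.
  move=> b /=; rewrite in_fsetU => /orP[/imfsetP[j _ ->]|/imfsetP[a aS ->]].
    by apply: Rx; exact: chart_gen.
  have [Rb _ _ nb] := dP _ (Sx _ aS); rewrite Ex; exists 1, (d a).
  by split => //; [case: sR|rewrite mul1r].
move=> O y lO TO cy.
have DO : [set` D] `<=` O.
  case: cy => yO _; apply: subset_trans yO; exact: model_base (ring_atP y).
have RO : R `<=` O.
  apply: chart_sub => //; first by case: lO.
  move=> j; apply: TO; rewrite /= in_fsetU; apply/orP; left.
  by apply/imfsetP; exists j.
have [A XA [cA RA invA]] := chart_center_model EX lO RO.
(* The center of [O] found on the chart of [x] is [y], so the denominators, which are invertible in
   [O], are invertible at [y]. *)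
rewrite (center_unique XA (ring_atP y) cA cy) in RA invA.
apply: SU => a aS.
have [Rb Rab b0 _] := dP _ (Sx _ aS).
have -> : a = a * d a * (d a)^-1 by rewrite mulfK.
have [[_ _ yM] _] := lf_local (ring_atP y).
apply: yM; first exact: RA.
apply: invA => //; apply: TO; rewrite /= in_fsetU; apply/orP; right.
by apply/imfsetP; exists a.
Qed.

End Centers.

(** * Quasicompactness and inverse closures *)

Section Topology.

Lemma open_local (T : topologicalType) (A : set T) :
  (forall t, A t -> exists W, [/\ open W, W t & W `<=` A]) -> open A.
Proof.
move=> h; rewrite openE => t /h[W [oW Wt WA]].
by rewrite /interior nbhsE; exists W.
Qed.

Lemma ring_at_inj (F : fieldType) (X : local_family F) :
  injective (@ring_at F X).
Proof. exact: val_inj. Qed.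

(** A finite subcover of [U] by basic open sets involves finitely many elements of [F], which are
    collected in [s]. *)
Lemma compact_open_finite (F : fieldType) (X : local_family F)
    (U : set (points X)) : open U -> compact U ->
  exists s : {fset F}, forall x, U x ->
    exists2 S : {fset F}, (S `<=` s)%fset & basic_open S x /\ basic_open S `<=` U.
Proof.
move=> /open_basicP oU cU; apply: contrapT => /forallNP ns.
(* The part of [U] not yet covered by means of [s]. If it is never empty, these sets generate a
   proper filter, and a basic neighborhood of a cluster point gives a contradiction. *)
pose B (s : {fset F}) := [set x | U x /\ forall S : {fset F}, (S `<=` s)%fset ->
  basic_open S `<=` U -> ~ basic_open S x].
pose G : set_system (points X) := filter_from setT B.
have GP : ProperFilter G.
  apply: filter_from_proper; last first.
    move=> s _; have /existsNP[x /not_implyP[Ux nx]] := ns s.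
    by exists x; split => // S Ss SU Sx; apply: nx; exists S.
  apply: filter_from_filter; first by exists fset0.
  move=> s s' _ _; exists (s `|` s')%fset => // x [Ux h].
  split; split => // S Ss; apply: h; apply: (fsubset_trans Ss).
    exact: fsubsetUl.
  exact: fsubsetUr.
have GU : G U by exists fset0 => // x [].
have [x [Ux clx]] := cU G GP GU.
have [S Sx SU] := oU x Ux.
have [||y [[_ /(_ S)]]] := clx (B S) (basic_open S); first by exists S.
  by rewrite nbhsE; exists (basic_open S) => //; split => //; exact: basic_open_open.
by move=> /(_ (fsubset_refl _) SU).
Qed.

Variables (F : fieldType) (D : subringClosed F).
Implicit Types (X Y : projective_model D) (V W : ZR D) (Z : set (ZR D)).

(** * The center map from the Zariski-Riemann space to a model *)

Definition point_of (X : local_family F) (A : set F) (XA : lf_set X A) :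
  points X := exist _ A (mem_set XA).

Lemma center_point X V : exists x : points (pm_family X),
  centered (ring_at V) (ring_at x).
Proof.
have [A XA cA] := center_exists X (ring_atP V).
by exists (@point_of (pm_family X) A XA).
Qed.

Definition zr_center X V : points (pm_family X) := projT1 (cid (center_point X V)).

Lemma zr_centerP X V : centered (ring_at V) (ring_at (zr_center X V)).
Proof. by rewrite /zr_center; case: cid. Qed.

Lemma center_point_unique X O (x y : points (pm_family X)) :
  centered O (ring_at x) -> centered O (ring_at y) -> x = y.
Proof.
by move=> cx cy; apply: ring_at_inj; exact: center_unique (ring_atP x) (ring_atP y) cx cy.
Qed.

Lemma zr_center_surj X x : exists V, zr_center X V = x.
Proof.
have [A [vA cA]] := dominating_valuation_ring (lf_local (ring_atP x)).
have zA : zr_set D A.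
  split => //; case: cA => xA _; apply: subset_trans xA.
  exact: model_base (ring_atP x).
exists (@point_of (zr_family D) A zA); apply: center_point_unique cA.
exact: zr_centerP.
Qed.

(** The finite set that [open_center_nbhd] attaches to [f t] lies in the ring at [r t], and it
    defines a neighborhood of [t] sent into [U]. With [r] general, this covers center maps,
    domination maps and their restrictions to subspaces. *)
Lemma continuous_center (T : topologicalType) (X1 : local_family F) X
    (r : T -> points X1) (f : T -> points (pm_family X)) :
  continuous r -> (forall t, centered (ring_at (r t)) (ring_at (f t))) ->
  continuous f.
Proof.
move=> /continuousP cr cf; apply/continuousP => U oU.
apply: open_local => t Ut; have [S [St SU]] := open_center_nbhd oU Ut.
exists (r @^-1` basic_open S); split.
- by apply: cr; exact: basic_open_open.
- by move=> a /St; case: (cf t) => h _; exact: h.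
- by move=> t' St'; apply: (SU _ _ (lf_local (ring_atP (r t')))).
Qed.

Lemma zr_center_continuous X : continuous (zr_center X).
Proof.
by apply: (@continuous_center _ _ _ id); [move=> ?; exact: cvg_id|exact: zr_centerP].
Qed.

(** Closure under ring operations needs only intersections of two sets of [G]; that [a] or its
    inverse belongs is where [G] must be an ultrafilter. *)
Lemma zr_ultra (G : set_system (ZR D)) : UltraFilter G ->
  exists V, forall a, ring_at V a <-> G [set W | ring_at W a].
Proof.
move=> UG; have PG : ProperFilter G by exact: ultra_proper.
pose A : set F := [set a | G [set W | ring_at W a]].
have all a : (forall W, ring_at W a) -> A a.
  by move=> h; apply: filterS filterT => W _; exact: h.
have sub W : is_subring (ring_at W) by case: (lf_local (ring_atP W)).
have zA : zr_set D A.
  split; last by move=> a Da; apply: all => W; case: (ring_atP W) => _; apply.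
  split.
    split; first by apply: all => W; case: (sub W).
      move=> a b Aa Ab; apply: filterS (filterI Aa Ab) => W [] /=.
      by case: (sub W) => _ + _; apply.
    move=> a b Aa Ab; apply: filterS (filterI Aa Ab) => W [] /=.
    by case: (sub W) => _ _; apply.
  move=> a; have [|na] := in_ultra_setVsetC [set W | ring_at W a] UG; first by left.
  right; apply: filterS na => W /= nWa.
  by case: (ring_atP W) => -[_ /(_ a)[]].
by exists (@point_of (zr_family D) A zA).
Qed.

(** The image of the ultrafilter has a cluster point [x] in [U]. A finite set [T] defining a
    neighborhood of [x] lies in almost every valuation ring, hence in the limit [V], whose center is
    therefore in [U]. *)
Lemma compact_zr_center X (U : set (points (pm_family X))) :
  open U -> compact U -> compact (zr_center X @^-1` U).
Proof.
move=> oU cU; rewrite compact_ultra => G UG GU.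
have PG : ProperFilter G by exact: ultra_proper.
have [V VG] := zr_ultra UG.
have [x [Ux clx]] := cU _ (fmap_proper_filter (zr_center X) PG) GU.
have [T [Tx TU]] := open_center_nbhd oU Ux.
have GT : G [set W | [set` T] `<=` ring_at W].
  (* Otherwise almost all centers would avoid a neighborhood of the cluster point. *)
  have [h|h] := in_ultra_setVsetC (zr_center X @^-1` basic_open T) UG.
    apply: filterS h => W TW; apply: subset_trans TW _.
    by case: (zr_centerP X W).
  have [|y [ny Ty]] := clx (~` basic_open T) (basic_open T) h.
    by rewrite nbhsE; exists (basic_open T) => //; split => //; exact: basic_open_open.
  by case: ny.
exists V; split.
  apply: (TU (ring_at V)); [exact: lf_local (ring_atP V)| |exact: zr_centerP].
  by move=> a Ta; apply/VG; apply: filterS GT => W; exact.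
move=> B; rewrite nbhsE => -[B' [oB' B'V] sB].
have /open_basicP/(_ V B'V)[S SV SB] := oB'.
have : G (\bigcap_(a in [set` S]) [set W | ring_at W a]).
  by apply: filter_bigI => a aS; apply/VG; exact: SV.
by apply: filterS => W h; apply: sB; apply: SB => a aS; exact: h.
Qed.

Lemma zr_center_inv Z X V : Defs.inv Z V -> Defs.inv (@centers _ _ Z X) (zr_center X V).
Proof.
move=> iV U [oU cU ZU]; apply: (iV (zr_center X @^-1` U)); split.
- by move/continuousP: (@zr_center_continuous X) => cc; apply: cc.
- exact: compact_zr_center.
- by move=> W ZW; apply: ZU; exists W => //; exact: zr_centerP.
Qed.

Lemma zr_center_image_preimage X (U : set (points (pm_family X))) :
  zr_center X @` (zr_center X @^-1` U) = U.
Proof.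
apply/seteqP; split=> [_ [V UV <-]//|x Ux].
by have [V Vx] := zr_center_surj x; exists V => //=; rewrite Vx.
Qed.

Lemma compact_zr_image X (C : set (ZR D)) : compact C -> compact (zr_center X @` C).
Proof.
apply: continuous_compact; apply: continuous_subspaceT.
exact: zr_center_continuous.
Qed.

(** The preimage in [Y] of a quasicompact open [U] is quasicompact: by surjectivity of the center
    map of [Y], it is the image of the quasicompact preimage of [U] in the Zariski-Riemann space. *)
Lemma dominates_inv Z X Y (x : points (pm_family X)) (y : points (pm_family Y)) :
  dominates Y X -> centered (ring_at y) (ring_at x) ->
  Defs.inv (@centers _ _ Z Y) y -> Defs.inv (@centers _ _ Z X) x.
Proof.
move=> dYX cyx iy U [oU cU ZU].
have mP (z : points (pm_family Y)) : exists w : points (pm_family X),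
    centered (ring_at z) (ring_at w).
  have [A XA cA] := dYX _ (ring_atP z).
  by exists (@point_of (pm_family X) A XA).
have [m {}mP] := choice mP.
have mE V : m (zr_center Y V) = zr_center X V.
  apply: (@center_point_unique _ (ring_at V)); last exact: zr_centerP.
  exact: centered_trans (zr_centerP Y V) (mP _).
have mc : continuous m.
  by apply: (@continuous_center _ _ _ id) => // ?; exact: cvg_id.
have <- : m y = x by apply: center_point_unique (mP y) cyx.
apply: (iy (m @^-1` U)); split.
- by move/continuousP: mc => cc; apply: cc.
- have -> : m @^-1` U = zr_center Y @` (zr_center X @^-1` U).
    rewrite -[LHS]zr_center_image_preimage; congr (_ @` _).
    by apply/seteqP; split=> V /=; rewrite mE.
  by apply: compact_zr_image; exact: compact_zr_center.
- move=> z [V ZV cV]; apply: ZU; exists V => //.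
  exact: centered_trans cV (mP z).
Qed.

(** * Reading membership in a valuation ring off its center *)

Definition decides X (a : F) := forall A, pm_set X A -> A a \/ A a^-1.

(** If the inverse of [a] is in [A], it is a unit of [O], hence a unit of [A]. *)
Lemma decides_center X a O A : decides X a -> pm_set X A -> centered O A ->
  O a -> A a.
Proof.
move=> dX /dX[//|Aa] cA Oa; rewrite -[a]invrK.
by apply: (centered_inv cA) => //; rewrite invrK.
Qed.

Lemma dominates_decides X Y a : dominates Y X -> decides X a -> decides Y a.
Proof.
by move=> dYX dX B /dYX[A /dX[] Aa [AB _]]; [left|right]; exact: AB.
Qed.

(** For nonzero [a], the model with coordinates 1 and [a] has charts generated by [a] and by its
    inverse. *)
Lemma exists_decides a : exists X, decides X a.
Proof.
(* Coordinates of a model must be nonzero; 0 itself lies in every local ring. *)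
pose b := if a == 0 then 1 else a.
have b0 : b != 0 by rewrite /b; case: (eqVneq a 0) => [_|//]; rewrite oner_eq0.
pose f (i : 'I_2) := if i == ord0 then 1 else b.
have f0 i : f i != 0 by rewrite /f; case: ifP => [_|//]; rewrite oner_eq0.
have ch : exists (n : nat) (g : 'I_n -> F),
    [/\ (0 < n)%N, forall i, g i != 0 & model_set D f = model_set D g].
  by exists 2%N, f.
exists (ProjectiveModel ch) => A XA.
have [sA _] : is_local_subring A := model_local XA.
have [a0|a0] := eqVneq a 0; first by left; rewrite a0; exact: subring0.
have Eb : b = a by rewrite /b (negPf a0).
case: XA => i [p [pp ->]].
have loc := localize_base (adjoin_subring D _) pp.
have f1 : f ord_max = a by rewrite -Eb.
have [i0|i1] := eqVneq i ord0; [left|right]; apply: loc.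
  by have := @chart_gen _ D _ f i ord_max; rewrite f1 i0 {2}/f eqxx divr1.
have := @chart_gen _ D _ f i ord0.
by rewrite {2 3}/f eqxx (negPf i1) div1r Eb.
Qed.

Lemma system_decides (S : set (projective_model D)) (s : seq F) :
  dominant_system S -> exists2 X, S X & forall a, a \in s -> decides X a.
Proof.
move=> dS; elim: s => [|a s [X SX dX]].
  have [X _] := exists_decides 0.
  by have [Y SY _] := dS X X; exists Y.
have [X' dX'] := exists_decides a.
have [Y SY [dYX dYX']] := dS X X'; exists Y => // b.
rewrite inE => /predU1P[->|/dX bs]; first exact: dominates_decides dX'.
exact: dominates_decides bs.
Qed.

(** On a model of [S] that decides the finitely many elements defining [U], the image of [U] is
    quasicompact open, and [U] is its full preimage. *)
Lemma inv_zr_of_centers (S : set (projective_model D)) Z V : dominant_system S ->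
  (forall X, S X -> Defs.inv (@centers _ _ Z X) (zr_center X V)) -> Defs.inv Z V.
Proof.
move=> dS iV U [oU cU ZU].
have [s sP] := compact_open_finite oU cU.
have [X SX dX] := system_decides s dS.
have dec (W : ZR D) (T : {fset F}) : (T `<=` s)%fset ->
    basic_open T W -> basic_open T (zr_center X W).
  move=> /fsubsetP Ts TW a aT; apply: (decides_center (dX a (Ts _ aT))).
  - exact: ring_atP.
  - exact: zr_centerP.
  - exact: TW.
have up (W : ZR D) (T : {fset F}) :
    basic_open T (zr_center X W) -> basic_open T W.
  by move=> TW; apply: subset_trans TW _; case: (zr_centerP X W).
have [W UW WV] : (zr_center X @` U) (zr_center X V).
  apply: (iV X SX); split; last 1 first.
  - move=> x [W ZW cx]; exists W; first exact: ZU.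
    exact: center_point_unique (zr_centerP X W) cx.
  - apply: open_local => _ [W UW <-]; have [T Ts [TW TU]] := sP W UW.
    exists (basic_open T); split; [exact: basic_open_open|exact: dec|].
    move=> x Tx; have [W' E] := zr_center_surj x; exists W' => //.
    by apply: TU; apply: up; rewrite E.
  - exact: compact_zr_image.
have [T Ts [TW TU]] := sP W UW.
by apply: TU; apply: up; rewrite -WV; exact: dec.
Qed.

End Topology.

(** * Morphisms given by centers *)

Section DominationMorphism.

Lemma maximal_ideal_nonunit (R : comPzRingType) (M : set R) a :
  maximal_ideal M -> M a -> ~ unit_elt a.
Proof.
move=> [iM MT _] Ma [b ab]; apply: MT; apply: ideal1 => //.
by rewrite -ab mulrC; case: iM => _ _; apply.
Qed.

Lemma nonunit_maximal_ideal (R : comPzRingType) (M : set R) a :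
  (forall a b : R, ~ unit_elt a -> ~ unit_elt b -> ~ unit_elt (a + b)) ->
  maximal_ideal M -> ~ unit_elt a -> M a.
Proof.
move=> nD mM na; have nu := maximal_ideal_nonunit mM.
have [iM MT Mmax] := mM.
have iN : is_ideal [set b : R | ~ unit_elt b].
  split=> // [|r b /= nb [c rbc]]; first by apply: nu; case: iM.
  by apply: nb; exists (r * c); rewrite mulrCA mulrA.
case: (Mmax _ iN nu) => [<- //|NT].
have : [set b : R | ~ unit_elt b] 1 by rewrite NT.
by case; exists 1; rewrite mulr1.
Qed.

Variable F : fieldType.

(** By [germ_unit], invertibility of a germ is that of its value in the local ring. Locality of
    stalk maps thus becomes a statement about subrings of [F]. *)
Lemma maximal_ideal_germ (X : local_family F) (Y : set (points X))
    (h : inverse_closed Y) (y : inv_lrs h) (M : set (stalk y))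
    (U : opens Y) (yU : oset U y) (s : sec U) : maximal_ideal M ->
  M (@germ (inv_lrs h) y U yU s) <-> max_ideal (ring_in y) (sec_val s).
Proof.
move=> mM.
have nu (V : opens Y) (yV : oset V y) (r : sec V) :
    ~ unit_elt (@germ (inv_lrs h) y V yV r) <->
    max_ideal (ring_in y) (sec_val r).
  split=> [n|[_ n] /germ_unit //].
  split; first by case: (secP r) => _; exact.
  by move=> e; apply: n; apply/germ_unit.
rewrite -(nu U yU); split=> [|n]; first exact: maximal_ideal_nonunit.
apply: nonunit_maximal_ideal => // a b.
have [_ yD] := ring_in_local y.
case: (germ_surj2 a b) => V [yV [r [r' [-> ->]]]].
by rewrite -germD => /nu mr /nu mr'; apply/nu; exact: yD.
Qed.

Variables (X1 X2 : local_family F) (Y1 : set (points X1)) (Y2 : set (points X2)).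
Hypotheses (h1 : inverse_closed Y1) (h2 : inverse_closed Y2).
Variable f : inv_lrs h1 -> inv_lrs h2.
Hypotheses (cont_f : continuous f)
  (centered_f : forall y : Y1, centered (ring_in y) (ring_in (f y : Y2))).

Section Sharp.
Variable U : opens Y2.
Let V : opens Y1 := preim_opens cont_f U.

(** The factor [one_on V] gives the inclusion when [V] is nonempty and the zero map when [V] is
    empty, which can happen for nonempty [U]. *)
Lemma dom_sharp_subproof (a : sec U) : sec_set V (one_on V * sec_val a).
Proof.
have [ne|e] := pselect (V !=set0); last first.
  by rewrite one_onF // mul0r; exact: sec_set0.
rewrite one_onT // mul1r; split=> [|y Vy]; first by left.
by case: (centered_f y) => sub _; apply: sub; case: (secP a) => _; exact.
Qed.

Definition dom_sharp (a : sec U) : sec V := Sec (dom_sharp_subproof a).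

Lemma dom_sharpE (a : sec U) : V !=set0 -> sec_val (dom_sharp a) = sec_val a.
Proof. by move=> ne; rewrite /sec_val /= one_onT // mul1r. Qed.

Lemma dom_sharp_is_zmod_morphism : zmod_morphism dom_sharp.
Proof. by move=> a b; apply: sec_inj; exact: mulrBr. Qed.

Lemma dom_sharp_is_monoid_morphism : monoid_morphism dom_sharp.
Proof.
have [[y Vy]|e] := pselect (V !=set0); last first.
  by split=> [|a b]; apply: sec_empty.
have ne : V !=set0 by exists y.
have neU : U !=set0 by exists (f y).
split=> [|a b]; apply: sec_inj.
  by rewrite dom_sharpE // /sec_val /= !one_onT.
by rewrite dom_sharpE // [RHS]/(_ * _) /sec_val /= !one_onT // !mul1r.
Qed.

HB.instance Definition _ := GRing.isZmodMorphism.Build (sec U) (sec V) dom_sharp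
  dom_sharp_is_zmod_morphism.
HB.instance Definition _ := GRing.isMonoidMorphism.Build (sec U) (sec V) dom_sharp
  dom_sharp_is_monoid_morphism.

End Sharp.

Lemma dom_natural (U V : opens (inv_lrs h2)) (h : V `<=` U)
  (k : preim_opens cont_f V `<=` preim_opens cont_f U) (s : sect U) :
  dom_sharp (res h s : sec V) = res k (dom_sharp (s : sec U) : @sect (inv_lrs h1) _).
Proof.
have [[y Vy]|e] := pselect (preim_opens cont_f V !=set0); last exact: sec_empty.
have neV : V !=set0 by exists (f y).
have neV' : preim_opens cont_f V !=set0 by exists y.
have neU' : preim_opens cont_f U !=set0 by exists y; exact: k.
apply: sec_inj; rewrite dom_sharpE // (sec_resE h) //.
by rewrite (sec_resE k) // dom_sharpE.
Qed.

Definition dom_rs_mor : rs_mor (inv_lrs h1) (inv_lrs h2) :=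
  @RsMor (inv_lrs h1) (inv_lrs h2) f cont_f (fun U => dom_sharp (U := U)) dom_natural.

Lemma dom_local (y : inv_lrs h1) : local_hom (@stalk_map _ _ dom_rs_mor y).
Proof.
move=> M N mM mN _ [g Mg <-].
case: (germ_surj g) => U [yU [s gE]]; move: Mg; rewrite gE stalk_map_germ.
move=> /(maximal_ideal_germ yU s mM) ms.
apply/(maximal_ideal_germ _ _ mN); rewrite dom_sharpE; last by exists y.
have [_ E] := centered_f y.
by move: ms; rewrite /ring_in /= E => -[].
Qed.

Lemma domination_morphism : exists phi : lrs_mor (inv_lrs h1) (inv_lrs h2),
  is_domination phi.
Proof.
exists (LrsMor dom_local); split=> // U s ne; exact: dom_sharpE.
Qed.

End DominationMorphism.

(** * The limit *)

Lemma comp_is_domination (F : fieldType) (X1 X2 X3 : local_family F)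
    (Y1 : set (points X1)) (Y2 : set (points X2)) (Y3 : set (points X3))
    (h1 : inverse_closed Y1) (h2 : inverse_closed Y2) (h3 : inverse_closed Y3)
    (psi : lrs_mor (inv_lrs h2) (inv_lrs h3))
    (phi : lrs_mor (inv_lrs h1) (inv_lrs h2)) :
  is_domination psi -> is_domination phi -> is_domination (comp_mor psi phi).
Proof.
move=> [psi1 psi2] [phi1 phi2]; split=> [y|U s [y Uy]].
  exact: centered_trans (phi1 y) (psi1 _).
have ne : preim_opens (mor_cont psi) U !=set0 by exists (phi y).
have ne' : preim_opens (mor_cont phi) (preim_opens (mor_cont psi) U) !=set0.
  by exists y.
rewrite -(psi2 U s ne) -(phi2 _ (mor_sharp psi U s) ne').
by apply: sec_resE; exists y.
Qed.

Section UniqueDomination.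
Variables (F : fieldType) (D : subringClosed F) (X1 : local_family F).
Variables (X2 : projective_model D).
Variables (Y1 : set (points X1)) (Y2 : set (points (pm_family X2))).
Variables (h1 : inverse_closed Y1) (h2 : inverse_closed Y2).

(** A ring dominates at most one local ring of a model, and both maps of sections preserve the value
    in [F]. *)
Lemma is_domination_unique (phi psi : lrs_mor (inv_lrs h1) (inv_lrs h2)) :
  is_domination phi -> is_domination psi -> mor_eq phi psi.
Proof.
move=> [phi1 phi2] [psi1 psi2]; split=> [y|U s W hf hg].
  by apply: val_inj; exact: center_point_unique (phi1 y) (psi1 y).
have [[y Wy]|ne] := pselect (W !=set0); last exact: sec_empty.
have neW : W !=set0 by exists y.
apply: sec_inj; rewrite (sec_resE hf) // (sec_resE hg) // phi2 ?psi2 //.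
  by exists y; exact: hg.
by exists y; exact: hf.
Qed.

End UniqueDomination.

(** Separatedness is applied to the cover by all open subsets on which [r] and [r'] agree. *)
Lemma sect_local_eq (T : ringed_space) (W : opens T) (r r' : sect W) :
  (forall z, oset W z ->
     exists (W' : opens T) (k : W' `<=` W), oset W' z /\ res k r = res k r') ->
  r = r'.
Proof.
move=> h; pose I := {W' : opens T & {k : W' `<=` W | res k r = res k r'}}.
apply: (@sheaf_separated T W I (fun i => projT1 i) (fun i => sval (projT2 i))).
  move=> z /h[W' [k [W'z e]]].
  by exists (existT _ W' (exist _ k e)).
by move=> [W' [k e]].
Qed.

Section Limit.
Variables (F : fieldType) (D : subringClosed F) (Z : set (ZR D)).
Variables (S : set (projective_model D)) (dS : dominant_system S).
Variable t : forall X X' : S, dominates (member X') (member X) ->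
  lrs_mor (inv_centers Z (member X')) (inv_centers Z (member X)).
Hypothesis tP : forall X X' (h : dominates (member X') (member X)),
  is_domination (t h).

Lemma system_upper (X X' : S) : exists X'' : S,
  dominates (member X'') (member X) /\ dominates (member X'') (member X').
Proof.
have [W SW dW] := dS (member X) (member X').
by exists (exist _ W (mem_set SW)).
Qed.

Lemma system_decides1 a : exists X : S, decides (member X) a.
Proof.
have [X SX dX] := system_decides [:: a] dS.
by exists (exist _ X (mem_set SX)); apply: dX; rewrite inE.
Qed.

Definition mring (X : S) (x : inv_centers Z (member X)) : set F :=
  @ring_in _ _ (Defs.inv (@centers _ _ Z (member X))) x.

Definition vring (V : inv_zr Z) : set F := @ring_in _ _ (Defs.inv Z) V.

Definition msec (X : S) (O : opens (inv_centers Z (member X))) (s : sect O) : F :=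
  @sec_val _ _ (Defs.inv (@centers _ _ Z (member X))) O s.

Definition vsec (U : opens (inv_zr Z)) (s : sect U) : F :=
  @sec_val _ _ (Defs.inv Z) U s.

Lemma pm_mring X (x : inv_centers Z (member X)) : pm_set (member X) (mring x).
Proof. exact: (@ring_atP _ (pm_family (member X))). Qed.

(** * The morphism to [inv_zr Z] induced by a cone *)

Section Cone.
Variables (T : locally_ringed_space)
  (q : forall X : S, lrs_mor T (inv_centers Z (member X))).
Hypothesis coneq : is_cone (S := InverseSystem t) q.

Lemma cone_centered X X' z : dominates (member X') (member X) ->
  centered (mring (q X' z)) (mring (q X z)).
Proof.
move=> h; have [e _] := coneq h; rewrite -(e z).
by have [c _] := tP h; exact: c.
Qed.

Definition limit_ring z : set F :=
  \bigcup_(A in [set mring (q X z) | X in [set: S]]) A.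

Lemma mem_limit_ring X z a : mring (q X z) a -> limit_ring z a.
Proof. by move=> h; exists (mring (q X z)) => //; exists X. Qed.

Lemma limit_ringP z a : limit_ring z a -> exists X, mring (q X z) a.
Proof. by move=> [_ [X _ <-] Xa]; exists X. Qed.

Lemma limit_ring_zr z : zr_set D (limit_ring z).
Proof.
have [X0 _] := system_decides1 0.
split; last first.
  move=> a Da; apply: (@mem_limit_ring X0).
  exact: (model_base (pm_mring (q X0 z))).
split.
  apply: directed_subring; first by exists (mring (q X0 z)); exists X0.
    move=> _ _ [X _ <-] [X' _ <-]; have [X'' [h h']] := system_upper X X'.
    exists (mring (q X'' z)); first by exists X''.
    move=> a [Xa|Xa]; first by case: (cone_centered z h) => + _; apply.
    by case: (cone_centered z h') => + _; apply.
  by move=> _ [X _ <-]; case: (model_local (pm_mring (q X z))).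
move=> a; have [X dX] := system_decides1 a.
by have [h|h] := dX _ (pm_mring (q X z)); [left|right]; exact: mem_limit_ring h.
Qed.

(** An inverse found at one member passes to a common upper bound, whose domination brings it back
    to [X]. *)
Lemma limit_ring_centered X z : centered (limit_ring z) (mring (q X z)).
Proof.
apply: centered_intro; first by move=> a; exact: mem_limit_ring.
move=> a Xa a0 /limit_ringP[X' Xa']; have [X'' [h h']] := system_upper X X'.
have cX := cone_centered z h; apply: (centered_inv cX) => //.
by case: (cone_centered z h') => + _; apply.
Qed.

Definition limit_zr z : ZR D := point_of (X := zr_family D) (limit_ring_zr z).

Lemma limit_zr_center X z :
  zr_center (member X) (limit_zr z) =
  \val (q X z : Defs.inv (@centers _ _ Z (member X))).
Proof.
apply: (@center_point_unique _ _ _ (limit_ring z)); first exact: zr_centerP.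
exact: limit_ring_centered.
Qed.

Lemma limit_zr_inv z : Defs.inv Z (limit_zr z).
Proof.
apply: (inv_zr_of_centers dS) => X SX.
have -> : X = member (exist _ X (mem_set SX) : S) by [].
rewrite limit_zr_center; exact: set_mem (valP _).
Qed.

Definition limit_fun (z : T) : inv_zr Z :=
  exist _ (limit_zr z) (mem_set (limit_zr_inv z)).

Lemma limit_funE z : vring (limit_fun z) = limit_ring z.
Proof. by []. Qed.

Lemma mring_open X (A : {fset F}) :
  open [set x : inv_centers Z (member X) | [set` A] `<=` mring x].
Proof. by exists (basic_open A) => //; exact: basic_open_open. Qed.

Lemma limit_ring_fset z (A : {fset F}) : [set` A] `<=` limit_ring z ->
  exists X, [set` A] `<=` mring (q X z).
Proof.
suff h (s : seq F) : (forall a, a \in s -> limit_ring z a) ->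
    exists X, forall a, a \in s -> mring (q X z) a.
  by move=> /(h (enum_fset A))[X hX]; exists X.
elim: s => [|a s IH] sz; first by have [X _] := system_decides1 0; exists X.
have [|X hX] := IH; first by move=> b bs; apply: sz; rewrite inE bs orbT.
have [|X' hX'] := @limit_ringP z a; first by apply: sz; rewrite inE eqxx.
have [X'' [h h']] := system_upper X X'; exists X'' => b.
rewrite inE => /predU1P[->|/hX bX].
  by case: (cone_centered z h') => + _; apply.
by case: (cone_centered z h) => + _; apply.
Qed.

(** The finite set defining a basic neighborhood already lies in the local ring at some [q X z],
    where it defines an open set to be pulled back along [q X]. *)
Lemma limit_fun_continuous : continuous limit_fun.
Proof.
apply/continuousP => _ [U oU <-]; apply: open_local => z /= Uz.
have /open_basicP/(_ _ Uz)[A Az AU] := oU.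
have [X AX] := limit_ring_fset Az.
exists (q X @^-1` [set x : inv_centers Z (member X) | [set` A] `<=` mring x]).
split => //; last first.
  move=> z' Az'; apply: AU; apply: subset_trans Az' _.
  by move=> a; exact: mem_limit_ring.
by move/continuousP: (mor_cont (q X)) => c; apply: c; exact: mring_open.
Qed.

(** * Sections over a cone represented by elements of [F] *)

Definition rep_at (W : opens T) (z : T) (a : F) (r : sect W) (X : S) : Prop :=
  exists (O : opens (inv_centers Z (member X))) (s : sect O) (W' : opens T)
    (k : W' `<=` W) (k' : W' `<=` preim_opens (mor_cont (q X)) O),
  [/\ oset W' z, msec s = a & res k r = res k' (mor_sharp (q X) O s)].

(* [r] is locally the image of the element [a] of [F], viewed as a section over
   an open set of some member of the system. *)
Definition rep (W : opens T) (a : F) (r : sect W) : Prop :=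
  forall z, oset W z -> exists X, rep_at z a r X.

(** The transition morphism preserves the value of [s], and the cone condition identifies the two
    images over [T]. *)
Lemma rep_at_up (W : opens T) z a (r : sect W) X X' :
  dominates (member X') (member X) -> rep_at z a r X -> rep_at z a r X'.
Proof.
move=> h [O [s [W' [k [k' [W'z sa e]]]]]].
have [cp cs] := coneq h.
have kc : W' `<=` preim_opens (mor_cont (comp_mor (t h) (q X'))) O.
  by move=> y W'y; have := k' y W'y; rewrite /= -(cp y).
exists (preim_opens (mor_cont (t h)) O), (mor_sharp (t h) O s), W', k, kc.
split=> //.
  rewrite -sa; have [_ ts] := tP h; apply: ts.
  by exists (q X' z); exact: (kc z W'z).
rewrite e -(cs O s W' kc k'); exact: res_res.
Qed.

(** Moving both representations to a common upper bound and intersecting reduces computations to one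
    ring of sections. *)
Lemma rep2 (W : opens T) z a1 a2 (r1 r2 : sect W) : oset W z ->
  rep a1 r1 -> rep a2 r2 ->
  exists (X : S) (O : opens (inv_centers Z (member X))) (s1 s2 : sect O)
    (W' : opens T) (k : W' `<=` W) (k' : W' `<=` preim_opens (mor_cont (q X)) O),
  [/\ oset W' z, msec s1 = a1, msec s2 = a2,
    res k r1 = res k' (mor_sharp (q X) O s1) &
    res k r2 = res k' (mor_sharp (q X) O s2)].
Proof.
move=> Wz /(_ z Wz)[X1 R1] /(_ z Wz)[X2 R2].
have [X [d1 d2]] := system_upper X1 X2.
have [O1 [s1 [W1 [k1 [k1' [W1z e1 E1]]]]]] := rep_at_up d1 R1.
have [O2 [s2 [W2 [k2 [k2' [W2z e2 E2]]]]]] := rep_at_up d2 R2.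
pose O := opensI O1 O2; pose W' := opensI W1 W2.
have O1s : O `<=` O1 by apply: subIsetl.
have O2s : O `<=` O2 by apply: subIsetr.
have W1s : W' `<=` W1 by apply: subIsetl.
have W2s : W' `<=` W2 by apply: subIsetr.
have kO : W' `<=` preim_opens (mor_cont (q X)) O.
  by move=> y [/k1' y1 /k2' y2].
have ne : O !=set0 by exists (q X z); exact: kO.
exists X, O, (res O1s s1), (res O2s s2), W', (subset_trans W1s k1), kO.
have P1 : preim_opens (mor_cont (q X)) O `<=` preim_opens (mor_cont (q X)) O1.
  by move=> y; exact: O1s.
have P2 : preim_opens (mor_cont (q X)) O `<=` preim_opens (mor_cont (q X)) O2.
  by move=> y; exact: O2s.
split=> //.
- by rewrite -e1; exact: sec_resE.
- by rewrite -e2; exact: sec_resE.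
- rewrite (mor_natural O1s P1) (res_res _ _ (subset_trans kO P1)).
  by rewrite -(res_res k1 W1s) E1; exact: res_res.
- rewrite (mor_natural O2s P2) (res_res _ _ (subset_trans kO P2)).
  by rewrite -(res_res k2 W2s (subset_trans W1s k1)) E2; exact: res_res.
Qed.

(** Sections of a model with the same value are equal. Identities between represented sections over
    [T] thereby reduce to identities in [F]. *)
Lemma rep_unique (W : opens T) a (r r' : sect W) : rep a r -> rep a r' -> r = r'.
Proof.
move=> R R'; apply: sect_local_eq => z Wz.
have [X [O [s [s' [W' [k [k' [W'z e e' E E']]]]]]]] := rep2 Wz R R'.
exists W', k; split=> //; rewrite E E'; congr (res _ (mor_sharp _ _ _)).
by apply: sec_inj; exact: etrans e (esym e').
Qed.

Lemma rep_sub (W : opens T) a b (r r' : sect W) :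
  rep a r -> rep b r' -> rep (a - b) (r - r').
Proof.
move=> R R' z Wz.
have [X [O [s [s' [W' [k [k' [W'z e e' E E']]]]]]]] := rep2 Wz R R'.
exists X, O, (s - s'), W', k, k'; split=> //; first by rewrite -e -e'.
by rewrite !rmorphB E E'.
Qed.

Lemma rep_mul (W : opens T) a b (r r' : sect W) :
  rep a r -> rep b r' -> rep (a * b) (r * r').
Proof.
move=> R R' z Wz.
have [X [O [s [s' [W' [k [k' [W'z e e' E E']]]]]]]] := rep2 Wz R R'.
exists X, O, (s * s'), W', k, k'; split=> //; first by rewrite -e -e'.
by rewrite !rmorphM E E'.
Qed.

Lemma rep_one (W : opens T) : rep 1 (1 : sect W).
Proof.
move=> z Wz; have [X _] := system_decides1 0.
have k' : W `<=` preim_opens (mor_cont (q X)) (topO _) by [].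
exists X, (topO _), 1, W, (@subset_refl _ _), k'; split=> //.
  by rewrite /msec /sec_val /= one_onT //; exists (q X z).
by rewrite !rmorph1.
Qed.

Lemma rep_eq (W : opens T) a b (r : sect W) :
  (W !=set0 -> a = b) -> rep a r -> rep b r.
Proof. by move=> ab R z Wz; rewrite -ab; [exact: R|exists z]. Qed.

Lemma rep_sharp X (O : opens (inv_centers Z (member X))) (s : sect O) :
  rep (msec s) (mor_sharp (q X) O s).
Proof.
move=> z Wz.
by exists X, O, s, _, (@subset_refl _ _), (@subset_refl _ _).
Qed.

Lemma rep_res (W V : opens T) a (r : sect W) (h : V `<=` W) :
  rep a r -> rep a (res h r).
Proof.
move=> R z Vz; have [X [O [s [W' [k [k' [W'z e E]]]]]]] := R z (h z Vz).
pose W2 := opensI W' V.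
have l : W2 `<=` W' by apply: subIsetl.
have l' : W2 `<=` V by apply: subIsetr.
exists X, O, s, W2, l', (subset_trans l k'); split=> //.
rewrite (res_res h l' (subset_trans l k)) -(res_res k l) E.
exact: res_res.
Qed.

Lemma rep_local (W : opens T) a (r : sect W) :
  (forall z, oset W z -> exists (V : opens T) (h : V `<=` W),
     oset V z /\ rep a (res h r)) -> rep a r.
Proof.
move=> H z /H[V [h [Vz /(_ z Vz)]]].
move=> [X [O [s [W' [k [k' [W'z e E]]]]]]].
exists X, O, s, W', (subset_trans k h), k'; split=> //.
by rewrite -E; apply/esym; exact: res_res.
Qed.

(** The set [O] is the locus where [a] is regular; if it is empty, the section is 0 whatever [a]
    is. *)
Lemma mring_section X a : exists (O : opens (inv_centers Z (member X))) (s : sect O),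
  (forall x, oset O x = mring x a) /\ (O !=set0 -> msec s = a).
Proof.
pose Y := Defs.inv (@centers _ _ Z (member X)).
pose O : opens Y := Opens (@open_ring_in _ _ Y a).
have sO : sec_set O (one_on O * a).
  have [ne|e] := pselect (O !=set0); last by rewrite one_onF // mul0r; exact: sec_set0.
  by rewrite one_onT // mul1r; split=> //; left.
exists O, (Sec sO); split=> // ne.
by rewrite /msec /sec_val /= one_onT // mul1r.
Qed.

(** The loci where [a] is regular at [q X z] cover [W] as [X] varies; the local sections glue, since
    [rep_unique] makes them agree on overlaps. *)
Lemma rep_exists (W : opens T) a :
  (forall z, oset W z -> limit_ring z a) -> exists r : sect W, rep a r.
Proof.
move=> Wa.
pose O X := projT1 (cid (mring_section X a)).
pose s X : sect (O X) := projT1 (cid (projT2 (cid (mring_section X a)))).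
have Os X : (forall x, oset (O X) x = mring x a) /\ (O X !=set0 -> msec (s X) = a).
  exact: projT2 (cid (projT2 (cid (mring_section X a)))).
pose V X := opensI W (preim_opens (mor_cont (q X)) (O X)).
have VW X : V X `<=` W by apply: subIsetl.
have VO X : V X `<=` preim_opens (mor_cont (q X)) (O X) by apply: subIsetr.
pose r X : sect (V X) := res (VO X) (mor_sharp (q X) (O X) (s X)).
have R X : rep a (r X).
  apply: (@rep_eq _ (msec (s X))); last by apply: rep_res; exact: rep_sharp.
  by move=> [z Vz]; have [_] := Os X; apply; exists (q X z); exact: (VO X z Vz).
have [||r' r'P] := @sheaf_gluing T W S V VW _ r.
- move=> z Wz; have [X Xa] := limit_ringP (Wa z Wz); exists X => //; split=> //.
  by rewrite /= (Os X).1.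
- by move=> X X' hi hj; apply: (@rep_unique _ a); exact: rep_res.
exists r'; apply: rep_local => z Wz.
have [X Xa] := limit_ringP (Wa z Wz); exists (V X), (VW X); rewrite r'P.
by split=> //; split=> //; rewrite /= (Os X).1.
Qed.

Let preu (U : opens (inv_zr Z)) : opens T := preim_opens limit_fun_continuous U.

Lemma limit_sharp_ex (U : opens (inv_zr Z)) (s : sect U) :
  exists r : sect (preu U), rep (vsec s) r.
Proof.
apply: rep_exists => z Uz; rewrite -limit_funE.
by case: (secP (s : @sec _ _ (Defs.inv Z) U)) => _; exact.
Qed.

Definition limit_sharp U (s : sect U) : sect (preu U) :=
  projT1 (cid (limit_sharp_ex s)).

Lemma limit_sharpP U (s : sect U) : rep (vsec s) (limit_sharp s).
Proof. by rewrite /limit_sharp; case: cid. Qed.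

Lemma limit_sharp_zmod U : zmod_morphism (@limit_sharp U).
Proof.
move=> s s'; apply: rep_unique (limit_sharpP _) _.
exact: rep_sub (limit_sharpP s) (limit_sharpP s').
Qed.

Lemma limit_sharp_monoid U : monoid_morphism (@limit_sharp U).
Proof.
split=> [|s s']; apply: rep_unique (limit_sharpP _) _.
  apply: (@rep_eq _ 1); last exact: rep_one.
  by move=> [z Uz]; rewrite /vsec /sec_val /= one_onT //; exists (limit_fun z).
exact: rep_mul (limit_sharpP s) (limit_sharpP s').
Qed.

HB.instance Definition _ U := GRing.isZmodMorphism.Build (sect U) (sect (preu U))
  (@limit_sharp U) (@limit_sharp_zmod U).
HB.instance Definition _ U := GRing.isMonoidMorphism.Build (sect U) (sect (preu U))
  (@limit_sharp U) (@limit_sharp_monoid U).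

Lemma limit_natural (U V : opens (inv_zr Z)) (h : V `<=` U)
  (k : preu V `<=` preu U) (s : sect U) :
  limit_sharp (res h s) = res k (limit_sharp s).
Proof.
apply: rep_unique (limit_sharpP _) _.
apply: (@rep_eq _ (vsec s)); last by apply: rep_res; exact: limit_sharpP.
by move=> [z Vz]; apply/esym; apply: sec_resE; exists (limit_fun z).
Qed.

Definition limit_rs_mor : rs_mor T (inv_zr Z) :=
  @RsMor T (inv_zr Z) limit_fun limit_fun_continuous
    (fun U => @limit_sharp U) limit_natural.

(** Near [z] the image of [s] comes from a section [s'] of some member with the same value. A
    non-unit of the limit ring lying in a dominated ring is a non-unit there, so locality of [q X]
    applies. *)
Lemma limit_local z : local_hom (@stalk_map _ _ limit_rs_mor z).
Proof.
move=> M N mM mN _ [g Mg <-].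
case: (germ_surj g) => U [zU [s gE]]; move: Mg; rewrite gE stalk_map_germ.
move=> /(maximal_ideal_germ zU s mM) ms.
have [X [O [s' [W' [k [k' [W'z e E]]]]]]] := @limit_sharpP U s z zU.
have zO : oset O (q X z) by exact: k' z W'z.
have -> : @germ T z (preu U) zU (mor_sharp limit_rs_mor U s) =
    stalk_map (@germ _ (q X z) O zO s').
  rewrite stalk_map_germ -(germ_res _ W'z k) -(germ_res _ W'z k').
  by congr germ.
have [M' [mM' _]] := lrs_local (q X z).
apply: (lrs_mor_local mM' mN).
exists (germ zO s') => //.
apply/(maximal_ideal_germ _ _ mM').
have [_ cE] := limit_ring_centered X z.
have -> : sec_val (s' : @sec _ _ (Defs.inv (@centers _ _ Z (member X))) O) = vsec s by [].
have : max_ideal (mring (q X z)) (vsec s).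
  rewrite cE; split=> //; rewrite -e.
  by case: (secP (s' : @sec _ _ (Defs.inv (@centers _ _ Z (member X))) O)) => _; apply.
by [].
Qed.

Definition limit_mor : lrs_mor T (inv_zr Z) := LrsMor limit_local.

Variable p : forall X : S, lrs_mor (inv_zr Z) (inv_centers Z (member X)).
Hypothesis pP : forall X, is_domination (p X).

Lemma limit_mor_comp X : mor_eq (comp_mor (p X) limit_mor) (q X).
Proof.
have [pc ps] := pP X; split=> [z|O s W hf hg].
  apply: val_inj; apply: (@center_point_unique _ _ _ (limit_ring z)).
    exact: pc.
  exact: limit_ring_centered.
apply: (@rep_unique _ (msec s)); last by apply: rep_res; exact: rep_sharp.
apply: rep_res; apply: rep_res.
apply: (@rep_eq _ (vsec (mor_sharp (p X) O s))); last exact: limit_sharpP.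
by move=> [z Wz]; apply: ps; exists (limit_fun z).
Qed.

(** The ring at [v z] dominates all the rings at the [q X z], so models deciding its elements show
    that it is their union. Near [v z], a section is the pullback of a section of some member, where
    [q] prescribes its image. *)
Lemma limit_mor_unique (v : lrs_mor T (inv_zr Z)) :
  (forall X, mor_eq (comp_mor (p X) v) (q X)) -> mor_eq v limit_mor.
Proof.
move=> vq.
have cv X z : centered (vring (v z)) (mring (q X z)).
  by have [<- _] := vq X; have [pc _] := pP X; exact: pc.
have vE z : vring (v z) = limit_ring z.
  apply/seteqP; split=> [a va|a /limit_ringP[X]]; last by case: (cv X z) => + _; apply.
  have [X dX] := system_decides1 a; apply: (@mem_limit_ring X).
  exact: (decides_center dX (pm_mring _) (cv X z)).
split=> [z|U s W hf hg].
  by apply: val_inj; apply: ring_at_inj; exact: vE.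
apply: (@rep_unique _ (vsec s)); last by apply: rep_res; exact: limit_sharpP.
move=> z Wz.
have [X Xa] : exists X, mring (q X z) (vsec s).
  apply: limit_ringP; rewrite -vE.
  by case: (secP (s : @sec _ _ (Defs.inv Z) U)) => _; apply; exact: (hf z Wz).
have [O [s' [Os sE]]] := mring_section X (vsec s).
have [vp vs] := vq X.
pose U' : opens (inv_zr Z) := opensI U (preim_opens (mor_cont (p X)) O).
have U'U : U' `<=` U by apply: subIsetl.
have U'O : U' `<=` preim_opens (mor_cont (p X)) O by apply: subIsetr.
pose W' := opensI W (preim_opens (mor_cont (q X)) O).
have k : W' `<=` W by apply: subIsetl.
have k' : W' `<=` preim_opens (mor_cont (q X)) O by apply: subIsetr.
have W'z : oset W' z by split=> //; rewrite /= Os.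
have kc : W' `<=` preim_opens (mor_cont (comp_mor (p X) v)) O.
  by move=> y /k'; rewrite /= -(vp y).
have kv : W' `<=` preim_opens (mor_cont v) U'.
  by move=> y W'y; split; [exact: hf (k y W'y)|exact: kc].
have P1 : preim_opens (mor_cont v) U' `<=` preim_opens (mor_cont v) U.
  by move=> y; exact: U'U.
have P2 : preim_opens (mor_cont v) U' `<=`
    preim_opens (mor_cont v) (preim_opens (mor_cont (p X)) O).
  by move=> y; exact: U'O.
have a_s' : msec s' = vsec s by apply: sE; exists (q X z); exact: (k' z W'z).
exists X, O, s', W', k, k'; split=> //.
(* Both sides have the value of [s] in [F], and [U'] is nonempty. *)
have e : res U'U s = res U'O (mor_sharp (p X) O s').
  have ne : U' !=set0 by exists (v z); exact: (kv z W'z).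
  apply: sec_inj; apply: etrans (sec_resE U'U _ ne) _.
  apply: etrans (esym (sec_resE U'O _ ne)).
  have [_ ps] := pP X; apply: etrans (esym a_s') (esym (ps O s' _)).
  by exists (v z); exact: (kc z W'z).
rewrite (res_res hf k (subset_trans kv P1)) -(res_res P1 kv).
rewrite -(mor_natural U'U P1) e (mor_natural U'O P2).
rewrite (res_res P2 kv (subset_trans kv P2)) -(vs O s' W' kc k').
by apply/esym; exact: res_res.
Qed.

End Cone.

(** The projections form a cone because dominations compose and a domination into a given model is
    unique. *)
Lemma domination_limit (p : forall X : S, lrs_mor (inv_zr Z) (inv_centers Z (member X))) :
  (forall X, is_domination (p X)) -> is_limit (S := InverseSystem t) p.
Proof.
move=> pP; split=> [X X' h|T q coneq].
  by apply: is_domination_unique (pP X); exact: comp_is_domination (tP h) (pP X').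
exists (limit_mor coneq); split=> [X|v]; first exact: limit_mor_comp.
exact: limit_mor_unique.
Qed.

End Limit.

(** * Existence of the transition morphisms and the projections *)

Section Existence.
Variables (F : fieldType) (D : subringClosed F) (Z : set (ZR D)).

Lemma set_type_val_continuous (T : topologicalType) (A : set T) :
  continuous (fun a : A => \val a).
Proof. by apply/continuousP => U oU; exists U. Qed.

Lemma continuous_to_subset (R T : topologicalType) (A : set T) (f : R -> A) :
  continuous (fun r => \val (f r)) -> continuous f.
Proof.
move=> /continuousP cf; apply/continuousP => _ [U oU <-].
by have := cf U oU.
Qed.

Lemma center_morphism (X1 : local_family F) (Y1 : set (points X1))
    (h1 : inverse_closed Y1) (X : projective_model D) :
  (forall y : Y1, exists x : points (pm_family X),
     Defs.inv (@centers _ _ Z X) x /\ centered (ring_in y) (ring_at x)) ->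
  exists phi : lrs_mor (inv_lrs h1) (inv_centers Z X), is_domination phi.
Proof.
move=> ex; pose Y := Defs.inv (@centers _ _ Z X).
have /choice[f fP] : forall y : Y1, exists x : Y, centered (ring_in y) (ring_in x).
  move=> y; have [x [ix cx]] := ex y.
  by exists (exist _ x (mem_set ix)).
apply: (@domination_morphism _ _ _ _ _ h1 _ f) => //.
apply: continuous_to_subset.
apply: (continuous_center (r := fun y : Y1 => \val y)) => //.
exact: set_type_val_continuous.
Qed.

Lemma transition_exists (X X' : projective_model D) : dominates X' X ->
  exists phi : lrs_mor (inv_centers Z X') (inv_centers Z X), is_domination phi.
Proof.
move=> d; apply: center_morphism => y.
have [A XA cA] := d _ (ring_atP (\val y)).
exists (point_of (X := pm_family X) XA); split=> //.
by apply: (dominates_inv (x := point_of (X := pm_family X) XA) d cA); exact: set_mem (valP y).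
Qed.

Lemma projection_exists (X : projective_model D) :
  exists phi : lrs_mor (inv_zr Z) (inv_centers Z X), is_domination phi.
Proof.
apply: center_morphism => V; exists (zr_center X (\val V)); split.
  by apply: zr_center_inv; exact: set_mem (valP V).
exact: zr_centerP.
Qed.

End Existence.

Theorem theorem5p2 (F : fieldType) (D : subringClosed F)
    (Z : set (ZR D)) (hZ : Z !=set0)
    (S : set (projective_model D)) (hS : dominant_system S) :
  exists (t : forall X X' : S, dominates (member X') (member X) ->
                lrs_mor (inv_centers Z (member X')) (inv_centers Z (member X)))
         (p : forall X : S, lrs_mor (inv_zr Z) (inv_centers Z (member X))),
    [/\ forall (X X' : S) (h : dominates (member X') (member X)),
          is_domination (t X X' h),
        forall X : S, is_domination (p X)
      & is_limit (S := InverseSystem t) p].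
Proof.
exists (fun X X' h => projT1 (cid (transition_exists Z h))).
exists (fun X => projT1 (cid (projection_exists Z (member X)))).
have tP X X' h := projT2 (cid (@transition_exists F D Z (member X) (member X') h)).
have pP X := projT2 (cid (@projection_exists F D Z (member X))).
split=> [X X' h|X|]; [exact: tP|exact: pP|].
by apply: domination_limit; [exact: hS|exact: tP|exact: pP].
Qed.
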